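(* Let $G$ be a locally compact Hausdorff group, let $(\mathcal{B},G,\alpha)$ be a $\mathrm{C}^*$-dynamical system, and let $\mathcal{A}\subseteq\mathcal{B}=\mathrm{C}^*(\mathcal{A})$ be an $\alpha$-invariant operator subalgebra generating $\mathcal{B}$. Suppose $\pi:\mathcal{B}\to\mathbb{B}(\mathcal{H})$ is a non-degenerate $*$-representation that has the unique extension property with respect to $\mathcal{A}$. Then $\pi_\alpha$ is the unique completely contractive completely positive extension of $\pi_\alpha|_{\mathcal{A}}$ to $\mathcal{B}$ with range contained in $\mathbb{B}(\mathcal{H})\overline{\otimes}L^\infty(G)$.
   Context: A $\mathrm{C}^*$-dynamical system $(\mathcal{B},G,\alpha)$ consists of a $\mathrm{C}^*$-algebra $\mathcal{B}$ and a point-norm continuous action $\alpha$ of $G$ on $\mathcal{B}$ by completely isometric automorphisms (i.e. $*$-automorphisms). An operator subalgebra is a norm-closed, not necessarily self-adjoint, subalgebra; $\alpha$-invariant means $\alpha_g(\mathcal{A})\subseteq\mathcal{A}$ for all $g\in G$; $\mathrm{C}^*(\mathcal{A})$ is the $\mathrm{C}^*$-algebra generated by $\mathcal{A}$. A $*$-representation $\pi:\mathcal{B}\to\mathbb{B}(\mathcal{H})$ has the unique extension property with respect to $\mathcal{A}$ if there is a unique completely positive completely contractive map $\psi:\mathcal{B}\to\mathbb{B}(\mathcal{H})$ with $\psi|_{\mathcal{A}}=\pi|_{\mathcal{A}}$ (namely $\psi=\pi$). $L^\infty(G)$ and $L^2(G)$ are with respect to left Haar measure, and $\mathbb{B}(\mathcal{H})\overline{\otimes}L^\infty(G)\subseteq\mathbb{B}(\mathcal{H}\otimes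 L^2(G))$ is the von Neumann algebra tensor product. The $*$-representation $\pi_\alpha:\mathcal{B}\to\mathbb{B}(\mathcal{H})\overline{\otimes}L^\infty(G)$ is defined by $\pi_\alpha(b)(g)=\pi(\alpha_g^{-1}(b))$ for $g\in G$; that is, under $\mathcal{H}\otimes L^2(G)\cong L^2(G;\mathcal{H})$, $(\pi_\alpha(b)\xi)(g)=\pi(\alpha_g^{-1}(b))\xi(g)$. *)

(* Defs.v *)
From HB Require Import structures.
From mathcomp Require Import all_boot all_order all_algebra.
From mathcomp Require Import ring_quotient.
From mathcomp Require Import all_classical all_reals all_analysis.
From mathcomp Require Import measurable_realfun.
From mathcomp Require Import complex ring lra.

Set Implicit Arguments.
Unset Strict Implicit.
Unset Printing Implicit Defensive.

Import Order.TTheory GRing.Theory Num.Theory.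
Import numFieldTopology.Exports numFieldNormedType.Exports.

Local Open Scope classical_set_scope.
Local Open Scope ring_scope.

HB.mixin Record Lmodule_isPreHilbert (R : realType) V
    & GRing.Lmodule R[i] V := {
  inner : V -> V -> R[i];
  inner_linear : forall a x y z,
    inner (a *: x + y) z = a * inner x z + inner y z;
  inner_conj : forall x y, inner y x = ((inner x y)^*)%C;
  inner_ge0 : forall x, 0 <= inner x x;
  inner_eq0 : forall x, inner x x = 0 -> x = 0 }.

#[short(type="preHilbertType")]
HB.structure Definition PreHilbert (R : realType) :=
  {V of GRing.Lmodule R[i] V & Lmodule_isPreHilbert R V}.

Definition hnorm (R : realType) (V : preHilbertType R) (x : V) : R :=
  Num.sqrt (complex.Re (inner x x)).

HB.mixin Record PreHilbert_isHilbert (R : realType) V & PreHilbert R V := {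
  hilbert_complete : forall u : nat -> V,
    (forall e : R, 0 < e -> exists N : nat, forall m n : nat,
      (N <= m)%N -> (N <= n)%N -> hnorm (u m - u n) < e) ->
    exists l : V, (fun n => hnorm (u n - l)) @ \oo --> (0 : R) }.

#[short(type="hilbertType")]
HB.structure Definition Hilbert (R : realType) :=
  {V of PreHilbert R V & PreHilbert_isHilbert R V}.

Section PreHilbertTheory.
Variables (R : realType) (V : preHilbertType R).
Implicit Types (x y z : V) (a : R[i]).

Lemma innerDl x y z : inner (x + y) z = inner x z + inner y z.
Proof. by rewrite -[x]scale1r inner_linear mul1r scale1r. Qed.

Lemma inner0l z : inner 0 z = 0.
Proof. by apply: (addrI (inner 0 z)); rewrite -innerDl !addr0. Qed.

Lemma innerZl a x z : inner (a *: x) z = a * inner x z.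
Proof. by rewrite -[a *: x]addr0 inner_linear inner0l addr0. Qed.

Lemma innerNl x z : inner (- x) z = - inner x z.
Proof. by rewrite -scaleN1r innerZl mulN1r. Qed.

Lemma innerDr x y z : inner x (y + z) = inner x y + inner x z.
Proof. by rewrite inner_conj innerDl rmorphD /= -!inner_conj. Qed.

Lemma innerZr a x y : inner x (a *: y) = (a^*)%C * inner x y.
Proof. by rewrite inner_conj innerZl rmorphM /= -inner_conj. Qed.

Lemma inner0r x : inner x 0 = 0.
Proof. by rewrite inner_conj inner0l conjc0. Qed.

Lemma innerNr x y : inner x (- y) = - inner x y.
Proof. by rewrite inner_conj innerNl rmorphN /= -inner_conj. Qed.

Lemma Re_innerC x y : complex.Re (inner x y) = complex.Re (inner y x).
Proof. by rewrite inner_conj; case: (inner y x). Qed.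

Lemma hnorm_ge0 x : 0 <= hnorm x. Proof. exact: sqrtr_ge0. Qed.

Lemma Re_inner_ge0 x : 0 <= complex.Re (inner x x).
Proof. by have := inner_ge0 x; rewrite lecE => /andP[]. Qed.

Lemma Im_innerxx x : complex.Im (inner x x) = 0.
Proof. by have := inner_ge0 x; rewrite lecE => /andP[/eqP]. Qed.

Lemma hnorm_sqr x : hnorm x ^+ 2 = complex.Re (inner x x).
Proof. exact/sqr_sqrtr/Re_inner_ge0. Qed.

Lemma innerxx x : inner x x = (hnorm x ^+ 2)%:C%C.
Proof.
by rewrite hnorm_sqr; move: (Im_innerxx x); case: (inner x x) => a b /= ->.
Qed.

Lemma hnorm_eq0 x : hnorm x = 0 -> x = 0.
Proof. by move=> h; apply: inner_eq0; rewrite innerxx h expr0n. Qed.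

Lemma hnorm0 : hnorm (0 : V) = 0.
Proof. by rewrite /hnorm inner0l sqrtr0. Qed.

Lemma hnormN x : hnorm (- x) = hnorm x.
Proof. by rewrite /hnorm innerNl innerNr opprK. Qed.

Lemma hnormB x y : hnorm (x - y) = hnorm (y - x).
Proof. by rewrite -hnormN opprB. Qed.

Lemma hnormD_sqr x y : hnorm (x + y) ^+ 2 =
  hnorm x ^+ 2 + hnorm y ^+ 2 + complex.Re (inner x y) *+ 2.
Proof.
by rewrite !hnorm_sqr innerDl !innerDr !raddfD /= (Re_innerC y x); ring.
Qed.

Lemma hnormZ_real (a : R) x : 0 <= a -> hnorm (a%:C%C *: x) = a * hnorm x.
Proof.
move=> a0; apply: (@pexpIrn _ 2%N) => //.
- exact: hnorm_ge0.
- by rewrite nnegrE mulr_ge0 ?hnorm_ge0.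
by rewrite exprMn !hnorm_sqr innerZl innerZr conjc_real; case: (inner x x) => b c /=; ring.
Qed.

Lemma inner_CS x y : complex.Re (inner x y) <= hnorm x * hnorm y.
Proof.
have [x0|x0] := eqVneq (hnorm x) 0.
  by rewrite (hnorm_eq0 x0) inner0l hnorm0 mul0r.
have [y0|y0] := eqVneq (hnorm y) 0.
  by rewrite (hnorm_eq0 y0) inner0r hnorm0 mulr0.
have nx : 0 < hnorm x by rewrite lt_def x0 hnorm_ge0.
have ny : 0 < hnorm y by rewrite lt_def y0 hnorm_ge0.
have := sqr_ge0 (hnorm ((hnorm y)%:C%C *: x + - ((hnorm x)%:C%C *: y))).
rewrite hnormD_sqr hnormN !hnormZ_real ?hnorm_ge0// innerNr innerZl innerZr.
rewrite conjc_real.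
have -> : complex.Re (- ((hnorm y)%:C%C * ((hnorm x)%:C%C * inner x y))) =
   - (hnorm y * hnorm x * complex.Re (inner x y)).
  by case: (inner x y) => b c /=; ring.
move=> H; have xy := mulr_gt0 nx ny.
rewrite -(ler_pM2l xy); lra.
Qed.

Lemma ler_hnormD x y : hnorm (x + y) <= hnorm x + hnorm y.
Proof.
rewrite -(@ler_pXn2r _ 2%N) ?nnegrE ?addr_ge0 ?hnorm_ge0//.
by rewrite hnormD_sqr; have := inner_CS x y; lra.
Qed.

Lemma ler_dist_hnorm x y : `|hnorm x - hnorm y| <= hnorm (x - y).
Proof.
rewrite ler_norml; apply/andP; split.
  by rewrite lerNl opprB lerBlDr hnormB -{1}(subrK x y) ler_hnormD.
by rewrite lerBlDr -{1}(subrK y x) ler_hnormD.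
Qed.

Lemma hnormD_sqr_le x y :
  hnorm (x + y) ^+ 2 <= 2 * (hnorm x ^+ 2 + hnorm y ^+ 2).
Proof.
have := hnormD_sqr x y; have := hnormD_sqr x (- y).
rewrite innerNr hnormN raddfN /=; have := sqr_ge0 (hnorm (x - y)); lra.
Qed.

Lemma hnormZ_sqr a x :
  hnorm (a *: x) ^+ 2 = (complex.Re a ^+ 2 + complex.Im a ^+ 2) * hnorm x ^+ 2.
Proof.
rewrite !hnorm_sqr innerZl innerZr; move: (Im_innerxx x).
by case: (inner x x) => b c /= ->; case: a => d e /=; ring.
Qed.

Lemma polarization x y : complex.Re (inner x y) =
  4^-1 * (hnorm (x + y) ^+ 2 - hnorm (x - y) ^+ 2).
Proof. by rewrite !hnormD_sqr hnormN innerNr raddfN /=; field. Qed.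

Lemma Im_inner x y :
  complex.Im (inner x y) = complex.Re (inner x (('i : R[i])%C *: y)).
Proof. by rewrite innerZr; case: (inner x y) => a b /=; ring. Qed.

End PreHilbertTheory.

Section L2fun.
Context d (T : measurableType d) (R : realType).
Variables (mu : {measure set T -> \bar R}) (H : preHilbertType R).
Implicit Types (f g : T -> H).

Definition simple_fct (s : T -> H) : Prop :=
  exists l : seq (set T * H),
    (forall p : set T * H, p \in l -> measurable p.1 /\ (mu p.1 < +oo)%E) /\
    s = fun t => \sum_(p <- l) (\1_(p.1) t : R[i]) *: p.2.

Definition strongly_measurable f : Prop :=
  exists s : nat -> T -> H, (forall n, simple_fct (s n)) /\
    forall t, (fun n => hnorm (s n t - f t)) @ \oo --> (0 : R).

Definition square_integrable f : Prop :=
  strongly_measurable f /\ (\int[mu]_t (hnorm (f t) ^+ 2)%:E < +oo)%E.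

Lemma simple_fctD a s1 s2 :
  simple_fct s1 -> simple_fct s2 -> simple_fct (a *: s1 + s2).
Proof.
move=> [l1 [m1 ->]] [l2 [m2 ->]].
exists ([seq (p.1, a *: p.2) | p <- l1] ++ l2); split.
  move=> p; rewrite mem_cat => /orP[/mapP[q /m1 ? ->]//|/m2//].
apply/funext => t; rewrite big_cat big_map /=; congr (_ + _).
transitivity (a *: \sum_(p <- l1) (\1_(p.1) t : R[i]) *: p.2) => //.
by rewrite scaler_sumr; apply: eq_bigr => p _; rewrite !scalerA mulrC.
Qed.

Lemma cvg0_squeeze (u v : R^nat) : (forall n, 0 <= u n <= v n) ->
  v @ \oo --> (0 : R) -> u @ \oo --> (0 : R).
Proof.
move=> uv v0; apply: (@squeeze_cvgr _ _ _ _ (cst 0) v) => //; last exact: cvg_cst.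
by apply: nearW => n; exact: uv.
Qed.

Lemma strongly_measurableD a f g :
  strongly_measurable f -> strongly_measurable g ->
  strongly_measurable (a *: f + g).
Proof.
move=> [s1 [ss1 c1]] [s2 [ss2 c2]]; exists (fun n => a *: s1 n + s2 n).
split=> [n|t]; first exact: simple_fctD.
pose A := Num.sqrt (complex.Re a ^+ 2 + complex.Im a ^+ 2).
have AZ (x : H) : hnorm (a *: x) = A * hnorm x :> R.
  apply: (@pexpIrn _ 2%N) => //; first exact: hnorm_ge0.
    by rewrite nnegrE mulr_ge0 ?hnorm_ge0 ?sqrtr_ge0.
  rewrite /= hnormZ_sqr exprMn /A; congr (_ * _); rewrite sqr_sqrtr; [by []|exact: addr_ge0 (sqr_ge0 _) (sqr_ge0 _)].
apply: (@cvg0_squeeze _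
  (fun n => A * hnorm (s1 n t - f t) + hnorm (s2 n t - g t))).
  move=> n; rewrite hnorm_ge0/= -AZ.
  have -> : (a *: s1 n + s2 n) t - (a *: f + g) t =
      a *: (s1 n t - f t) + (s2 n t - g t).
    by rewrite scalerBr /= opprD addrACA.
  exact: ler_hnormD.
rewrite -[X in _ --> X](addr0 (0 : R)) -[X in X + _](mulr0 A).
by apply: cvgD => //; apply: cvgMr.
Qed.

Lemma measurable_Re_inner_simple s1 s2 : simple_fct s1 -> simple_fct s2 ->
  measurable_fun setT (fun t => complex.Re (inner (s1 t) (s2 t))).
Proof.
move=> [l1 [m1 ->]] [l2 [m2 ->]].
have -> : (fun t => complex.Re (inner
      (\sum_(p <- l1) (\1_(p.1) t : R[i]) *: p.2)
      (\sum_(p <- l2) (\1_(p.1) t : R[i]) *: p.2))) =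
  (fun t => \sum_(p <- l1) \sum_(q <- l2)
     \1_(p.1) t * (\1_(q.1) t * complex.Re (inner p.2 q.2))).
  apply/funext => t.
  have E1 (x : H) : complex.Re (inner (\sum_(p <- l1) (\1_(p.1) t : R[i]) *: p.2) x)
      = \sum_(p <- l1) \1_(p.1) t * complex.Re (inner p.2 x).
    elim: (l1) => [|p l IH]; first by rewrite !big_nil inner0l.
    rewrite !big_cons innerDl innerZl raddfD /= IH; congr (_ + _).
    by rewrite !indicE; case: (inner _ _) => b c /=; case: (t \in _) => /=; ring.
  rewrite E1; apply: eq_bigr => p _; rewrite -mulr_sumr; congr (_ * _).
  elim: (l2) => [|q l IH]; first by rewrite !big_nil inner0r.
  rewrite !big_cons innerDr innerZr raddfD /= IH; congr (_ + _).
  by rewrite !indicE; case: (inner _ _) => b c /=; case: (t \in _) => /=; ring.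
elim: l1 m1 => [|p l1 IH] m1.
  by under eq_fun do rewrite big_nil; exact: measurable_cst.
under eq_fun do rewrite big_cons.
apply: measurable_funD; last by apply: IH => q ql; apply: m1; rewrite inE ql orbT.
elim: l2 m2 {IH} => [|q l2 IH] m2.
  by under eq_fun do rewrite big_nil; exact: measurable_cst.
under eq_fun do rewrite big_cons.
apply: measurable_funD; last by apply: IH => r rl; apply: m2; rewrite inE rl orbT.
have [mp _] := m1 p (mem_head _ _); have [mq _] := m2 q (mem_head _ _).
apply: measurable_funM; first exact: measurable_indic.
by apply: measurable_funM; [exact: measurable_indic|exact: measurable_cst].
Qed.

Lemma measurable_hnorm f : strongly_measurable f ->
  measurable_fun setT (fun t => hnorm (f t)).
Proof.
move=> [s [ss sf]].
apply: (@measurable_fun_cvg _ _ _ setT (fun n t => hnorm (s n t))).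
  move=> n; rewrite /hnorm.
  apply: (@measurableT_comp _ _ _ _ _ _ (@Num.sqrt R)).
    apply: continuous_measurable_fun (@sqrt_continuous R).
  exact: measurable_Re_inner_simple.
move=> t _; apply/cvgrPdist_lt => e e0.
have /cvgrPdist_lt/(_ e e0) := sf t.
apply: filterS => n; rewrite sub0r normrN ger0_norm ?hnorm_ge0//.
by apply: le_lt_trans; rewrite distrC ler_dist_hnorm.
Qed.

Lemma measurable_Re_inner f g :
  strongly_measurable f -> strongly_measurable g ->
  measurable_fun setT (fun t => complex.Re (inner (f t) (g t))).
Proof.
move=> mf mg; under eq_fun do rewrite polarization.
apply: measurable_funM; first exact: measurable_cst.
have h (a : R[i]) : strongly_measurable (a *: g + f).
  exact: strongly_measurableD.
apply: measurable_funB; apply: measurable_funX; apply: measurable_hnorm.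
  by have := h 1; rewrite scale1r addrC.
by have := h (-1); rewrite scaleN1r addrC.
Qed.

Lemma square_integrableP f : square_integrable f <-> strongly_measurable f /\
  mu.-integrable setT (EFin \o (fun t => hnorm (f t) ^+ 2)).
Proof.
split=> -[mf h]; split => //.
  apply/integrableP; split.
    apply/measurable_EFinP; apply: measurable_funX; exact: measurable_hnorm.
  by under eq_integral do rewrite /= ger0_norm ?sqr_ge0//.
move/integrableP : h => [_]; apply: le_lt_trans.
by under [X in (_ <= X)%E]eq_integral do rewrite /= ger0_norm ?sqr_ge0//.
Qed.

Lemma square_integrable0 : square_integrable 0.
Proof.
split; last first.
  by under eq_integral do rewrite hnorm0 expr0n/=; rewrite integral0 ltry.
exists (fun=> 0); split=> [n|t].
  exists [::]; split => //; by apply/funext => t; rewrite big_nil.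
by under eq_fun do rewrite subrr hnorm0; exact: cvg_cst.
Qed.

Lemma square_integrableD a f g : square_integrable f -> square_integrable g ->
  square_integrable (a *: f + g).
Proof.
move=> /square_integrableP[mf If] /square_integrableP[mg Ig].
have mfg := strongly_measurableD a mf mg.
apply/square_integrableP; split=> //.
pose A := complex.Re a ^+ 2 + complex.Im a ^+ 2.
pose k t := 2 * A * hnorm (f t) ^+ 2 + 2 * hnorm (g t) ^+ 2.
apply: (@le_integrable _ _ _ mu setT measurableT _ (EFin \o k)).
- apply/measurable_EFinP; apply: measurable_funX; exact: measurable_hnorm.
- move=> t _ /=; rewrite lee_fin ger0_norm ?sqr_ge0//.
  apply: le_trans (ler_norm _); rewrite /k -mulrA -mulrDr -hnormZ_sqr.
  exact: hnormD_sqr_le.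
- have -> : EFin \o k = ((fun t => ((2 * A)%:E * (hnorm (f t) ^+ 2)%:E)%E) \+
      (fun t => (2%:E * (hnorm (g t) ^+ 2)%:E)%E))%E.
    by apply/funext => t; rewrite /= /k EFinD !EFinM.
  by apply: integrableD => //; apply: integrableZl.
Qed.

Lemma integrable_Re_inner f g : square_integrable f -> square_integrable g ->
  mu.-integrable setT (EFin \o (fun t => complex.Re (inner (f t) (g t)))).
Proof.
move=> sf sg; have [mf _] := sf; have [mg _] := sg.
have := square_integrableD 1 sf sg; rewrite scale1r.
move=> /square_integrableP[_ h1].
have := square_integrableD (-1) sg sf; rewrite scaleN1r addrC.
move=> /square_integrableP[_ h2].
have -> : EFin \o (fun t => complex.Re (inner (f t) (g t))) =
  (fun t => ((4^-1)%:E * (((EFin \o (fun t => hnorm ((f + g) t) ^+ 2)%R)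
     \- (EFin \o (fun t => hnorm ((f - g) t) ^+ 2)%R)) t))%E).
  by apply/funext => t; rewrite /= polarization EFinM EFinB.
by apply: integrableZl => //; apply: integrableB.
Qed.

End L2fun.

Section L2space.
Context d (T : measurableType d) (R : realType).
Variables (mu : {measure set T -> \bar R}) (H : preHilbertType R).

Definition L2pred : {pred T -> H} := [pred f | `[< square_integrable mu f >]].

Lemma L2predP f : reflect (square_integrable mu f) (f \in L2pred).
Proof. exact: asboolP. Qed.

Lemma L2pred_submod_closed : submod_closed L2pred.
Proof.
split; first exact/L2predP/square_integrable0.
move=> a f g /L2predP sf /L2predP sg; exact/L2predP/square_integrableD.
Qed.

HB.instance Definition _ := GRing.isSubmodClosed.Build R[i] (T -> H) L2pred
  L2pred_submod_closed.

Record L2fun := MkL2fun { L2val :> T -> H; _ : L2val \in L2pred }.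
HB.instance Definition _ := [isSub for L2val].
HB.instance Definition _ := [Choice of L2fun by <:].
HB.instance Definition _ := [SubChoice_isSubLmodule of L2fun by <:].

Lemma L2funP (f : L2fun) : square_integrable mu f.
Proof. by apply/L2predP; exact: valP. Qed.

Lemma L2valP a (f g : L2fun) t : L2val (a *: f + g) t = a *: f t + g t.
Proof. by []. Qed.

Definition L2null : {pred L2fun} := [pred f : L2fun | `[< {ae mu, forall t, f t = 0} >]].

Lemma L2nullP (f : L2fun) : reflect {ae mu, forall t, f t = 0} (f \in L2null).
Proof. exact: asboolP. Qed.

Lemma L2null_submod_closed : submod_closed L2null.
Proof.
split; first by apply/L2nullP; apply: nearW.
move=> a f g /L2nullP f0 /L2nullP g0; apply/L2nullP.
by apply: filterS2 f0 g0 => t f0 g0; rewrite L2valP f0 g0 scaler0 addr0.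
Qed.

HB.instance Definition _ := GRing.isSubmodClosed.Build R[i] L2fun L2null
  L2null_submod_closed.

(** Only the inner product structure of [L2 mu H] is recorded; when [H] is a
    Hilbert space, [L2 mu H] is complete by the Riesz-Fischer theorem. *)
Definition L2 := Quotient.quot L2null.
HB.instance Definition _ := GRing.Zmodule.on L2.

Definition L2class (f : L2fun) : L2 := \pi_(Quotient.quot L2null)%qT f.

Lemma L2class_eqE f g : L2class f = L2class g <-> (f - g) \in L2null.
Proof.
by rewrite /L2class (Quotient.idealrBE L2null); split => /eqP.
Qed.

Lemma L2class_eq (f g : L2fun) :
  L2class f = L2class g <-> {ae mu, forall t, f t = g t}.
Proof.
rewrite L2class_eqE.
have E t : (f - g) t = f t - g t by [].
split=> [/L2nullP h|h]; last apply/L2nullP; apply: filterS h => t.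
  by rewrite E => /subr0_eq.
by rewrite E => ->; rewrite subrr.
Qed.

Lemma L2class_surj (x : L2) : exists f, x = L2class f.
Proof. by exists (repr x); rewrite /L2class reprK. Qed.

Lemma L2classD f g : L2class (f + g) = L2class f + L2class g.
Proof. exact: (raddfD (\pi_(Quotient.quot L2null)%qT)). Qed.

Definition L2scale (a : R[i]) (x : L2) : L2 := L2class (a *: repr x).

Lemma L2classZ a f : L2class (a *: f) = L2scale a (L2class f).
Proof.
apply/L2class_eqE; rewrite -scalerBr; apply: rpredZ; apply/L2class_eqE.
by rewrite /L2class reprK.
Qed.

Lemma L2scaleA a b x : L2scale a (L2scale b x) = L2scale (a * b) x.
Proof. by have [f ->] := L2class_surj x; rewrite -!L2classZ scalerA. Qed.

Lemma L2scale1 : left_id 1 L2scale.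
Proof. by move=> x; have [f ->] := L2class_surj x; rewrite -L2classZ scale1r. Qed.

Lemma L2scaleDr : right_distributive L2scale +%R.
Proof.
move=> a x y; have [f ->] := L2class_surj x; have [g ->] := L2class_surj y.
by rewrite -L2classD -!L2classZ scalerDr L2classD.
Qed.

Lemma L2scaleDl x : {morph L2scale^~ x : a b / a + b}.
Proof.
move=> a b; have [f ->] := L2class_surj x.
by rewrite -!L2classZ scalerDl L2classD.
Qed.

HB.instance Definition _ := GRing.Zmodule_isLmodule.Build R[i] L2
  L2scaleA L2scale1 L2scaleDr L2scaleDl.

Lemma L2class_linear a f g : L2class (a *: f + g) = a *: L2class f + L2class g.
Proof. by rewrite L2classD L2classZ. Qed.

(** The inner product of [f] and [g] is the integral of [<f t, g t>]; real and
    imaginary parts are integrated separately. *)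
Definition L2fun_inner (f g : T -> H) : R[i] :=
  ((\int[mu]_t complex.Re (inner (f t) (g t)))
   +i* (\int[mu]_t complex.Im (inner (f t) (g t))))%C.

Definition L2inner (x y : L2) : R[i] := L2fun_inner (repr x) (repr y).

Lemma integrable_Re (f g : L2fun) :
  mu.-integrable setT (EFin \o (fun t => complex.Re (inner (f t) (g t)))).
Proof. exact: integrable_Re_inner (L2funP f) (L2funP g). Qed.

Lemma integrable_Im (f g : L2fun) :
  mu.-integrable setT (EFin \o (fun t => complex.Im (inner (f t) (g t)))).
Proof.
have := integrable_Re f (('i : R[i])%C *: g).
by congr (mu.-integrable _ (EFin \o _)); apply/funext => t; rewrite Im_inner.
Qed.

Lemma L2fun_inner_ae (f f' g g' : L2fun) :
  {ae mu, forall t, f t = f' t} -> {ae mu, forall t, g t = g' t} ->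
  L2fun_inner f g = L2fun_inner f' g'.
Proof.
move=> ff gg.
have aux (F G : T -> R) : mu.-integrable setT (EFin \o F) ->
    mu.-integrable setT (EFin \o G) -> {ae mu, forall t, F t = G t} ->
    \int[mu]_t F t = \int[mu]_t G t.
  move=> /measurable_int mF /measurable_int mG FG; congr fine.
  by apply: ae_eq_integral => //; apply: filterS FG => t /= -> _.
rewrite /L2fun_inner; congr (_ +i* _)%C.
- apply: aux; [exact: integrable_Re|exact: integrable_Re|].
  by apply: filterS2 ff gg => t -> ->.
- apply: aux; [exact: integrable_Im|exact: integrable_Im|].
  by apply: filterS2 ff gg => t -> ->.
Qed.

Lemma ae_repr (f : L2fun) : {ae mu, forall t, repr (L2class f) t = f t}.
Proof. by apply/L2class_eq; rewrite /L2class reprK. Qed.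

Lemma L2inner_class (f g : L2fun) :
  L2inner (L2class f) (L2class g) = L2fun_inner f g.
Proof. exact: L2fun_inner_ae (ae_repr f) (ae_repr g). Qed.

Lemma L2inner_linear a x y z :
  L2inner (a *: x + y) z = a * L2inner x z + L2inner y z.
Proof.
have [f ->] := L2class_surj x; have [g ->] := L2class_surj y.
have [h ->] := L2class_surj z; rewrite -L2class_linear !L2inner_class.
have E t : inner ((a *: f + g) t) (h t) =
    a * inner (f t) (h t) + inner (g t) (h t).
  by rewrite -inner_linear.
have Re_fh := integrable_Re f h; have Im_fh := integrable_Im f h.
have Re_gh := integrable_Re g h; have Im_gh := integrable_Im g h.
have iZ (r : R) (F : T -> R) : mu.-integrable setT (EFin \o F) ->
    mu.-integrable setT (EFin \o (fun t => r * F t)).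
  move=> iF; have -> : EFin \o (fun t => r * F t) =
      (fun t => (r%:E * (EFin \o F) t)%E) by [].
  exact: integrableZl.
rewrite /L2fun_inner.
under eq_Rintegral do rewrite E.
under [X in (_ +i* X)%C]eq_Rintegral do rewrite E.
case: a E => a b E.
have -> : \int[mu]_t complex.Re ((a +i* b)%C * inner (f t) (h t) + inner (g t) (h t))
    = a * (\int[mu]_t complex.Re (inner (f t) (h t)))
    - b * (\int[mu]_t complex.Im (inner (f t) (h t)))
    + \int[mu]_t complex.Re (inner (g t) (h t)).
  rewrite -!RintegralZl// -RintegralB//; [|exact: iZ|exact: iZ].
  rewrite -RintegralD//; last first.
    have -> : EFin \o (fun t => a * complex.Re (inner (f t) (h t))
        - b * complex.Im (inner (f t) (h t))) =
      ((EFin \o (fun t => (a * complex.Re (inner (f t) (h t)))%R))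
        \- (EFin \o (fun t => (b * complex.Im (inner (f t) (h t)))%R)))%E by [].
    by apply: integrableB => //; exact: iZ.
  apply: eq_Rintegral => t _.
  by case: (inner (f t) _) => u v; case: (inner (g t) _).
have -> : \int[mu]_t complex.Im ((a +i* b)%C * inner (f t) (h t) + inner (g t) (h t))
    = a * (\int[mu]_t complex.Im (inner (f t) (h t)))
    + b * (\int[mu]_t complex.Re (inner (f t) (h t)))
    + \int[mu]_t complex.Im (inner (g t) (h t)).
  rewrite -!RintegralZl// -RintegralD//; [|exact: iZ|exact: iZ].
  rewrite -RintegralD//; last first.
    have -> : EFin \o (fun t => a * complex.Im (inner (f t) (h t))
        + b * complex.Re (inner (f t) (h t))) =
      ((EFin \o (fun t => (a * complex.Im (inner (f t) (h t)))%R))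
        \+ (EFin \o (fun t => (b * complex.Re (inner (f t) (h t)))%R)))%E by [].
    by apply: integrableD => //; exact: iZ.
  apply: eq_Rintegral => t _.
  by case: (inner (f t) _) => u v; case: (inner (g t) _).
by [].
Qed.

Lemma L2inner_conj x y : L2inner y x = ((L2inner x y)^*)%C.
Proof.
have [f ->] := L2class_surj x; have [g ->] := L2class_surj y.
rewrite !L2inner_class /L2fun_inner /=; congr (_ +i* _)%C.
  by apply: eq_Rintegral => t _; rewrite Re_innerC.
rewrite -mulN1r -RintegralZl//; last exact: integrable_Im.
apply: eq_Rintegral => t _; rewrite inner_conj mulN1r.
by case: (inner (f t) _).
Qed.

Lemma L2innerxx (f : L2fun) :
  L2fun_inner f f = ((\int[mu]_t (hnorm (f t) ^+ 2))%:C)%C.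
Proof.
rewrite /L2fun_inner; congr (_ +i* _)%C.
  by apply: eq_Rintegral => t _; rewrite hnorm_sqr.
rewrite (_ : (fun t => _) = cst 0); last first.
  by apply/funext => t; rewrite Im_innerxx.
by rewrite Rintegral_cst// mul0r.
Qed.

Lemma L2inner_ge0 x : 0 <= L2inner x x.
Proof.
have [f ->] := L2class_surj x; rewrite L2inner_class L2innerxx.
by rewrite lecR; apply: Rintegral_ge0 => t _; exact: sqr_ge0.
Qed.

Lemma L2inner_eq0 x : L2inner x x = 0 -> x = 0.
Proof.
have [f ->] := L2class_surj x; rewrite L2inner_class L2innerxx => -[h].
have If : mu.-integrable setT (EFin \o (fun t => hnorm (f t) ^+ 2)).
  by have /square_integrableP[] := L2funP f.
have I0 : (\int[mu]_t `|(hnorm (f t) ^+ 2)%:E| = 0)%E.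
  under eq_integral do rewrite gee0_abs ?lee_fin ?sqr_ge0//.
  rewrite -[LHS]fineK; last exact: integrable_fin_num.
  by congr (_%:E); exact: h.
have /ae_eq_integral_abs := I0.
move=> /(_ measurableT (measurable_int _ If)) f0.
have -> : 0 = L2class 0 by symmetry; exact: raddf0 (\pi_(Quotient.quot L2null)%qT).
apply/L2class_eq; apply: filterS f0 => t /(_ I)[] /eqP.
by rewrite sqrf_eq0 => /eqP /hnorm_eq0.
Qed.

HB.instance Definition _ := Lmodule_isPreHilbert.Build R L2
  L2inner_linear L2inner_conj L2inner_ge0 L2inner_eq0.

End L2space.

(** [*]-algebras over [R[i]], not necessarily unital; MathComp rings are unital,
    hence the separate multiplication [smul]. *)
HB.mixin Record Lmodule_isStarAlgebra (R : realType) B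
    & GRing.Lmodule R[i] B := {
  smul : B -> B -> B;
  star : B -> B;
  smulA : associative smul;
  smul_linearl : forall a x y z,
    smul (a *: x + y) z = a *: smul x z + smul y z;
  smul_linearr : forall a x y z,
    smul z (a *: x + y) = a *: smul z x + smul z y;
  starK : involutive star;
  star_linear : forall a x y, star (a *: x + y) = (a^*)%C *: star x + star y;
  starM : forall x y, star (smul x y) = smul (star y) (star x) }.

#[short(type="starAlgType")]
HB.structure Definition StarAlgebra (R : realType) :=
  {B of GRing.Lmodule R[i] B & Lmodule_isStarAlgebra R B}.

Record cstar_norm (R : realType) (B : starAlgType R) (nu : B -> R) : Prop := {
  cstar_norm_eq0 : forall x, nu x = 0 -> x = 0;
  cstar_normZ : forall (a : R[i]) x, ((nu (a *: x))%:C)%C = `|a| * ((nu x)%:C)%C;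
  cstar_normD : forall x y, nu (x + y) <= nu x + nu y;
  cstar_normM : forall x y, nu (smul x y) <= nu x * nu y;
  cstar_norm_star : forall x, nu (smul (star x) x) = nu x ^+ 2;
  cstar_norm_complete : forall u : nat -> B,
    (forall e : R, 0 < e -> exists N : nat, forall m n : nat,
      (N <= m)%N -> (N <= n)%N -> nu (u m - u n) < e) ->
    exists l : B, (fun n => nu (u n - l)) @ \oo --> (0 : R) }.

HB.mixin Record StarAlgebra_isCStar (R : realType) B & StarAlgebra R B := {
  cnorm : B -> R;
  cnormP : cstar_norm cnorm }.

#[short(type="cstarAlgType")]
HB.structure Definition CStarAlgebra (R : realType) :=
  {B of StarAlgebra R B & StarAlgebra_isCStar R B}.

Section Matrices.
Variables (R : realType) (n : nat).

(** The [*]-algebra [M_n(B)]; ['M[B]_n] is not a left module when [B] is only a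
    module, and its product requires a unital ring. *)
Definition mxalg (B : Type) : Type := 'I_n -> 'I_n -> B.

Variable B : starAlgType R.

HB.instance Definition _ := GRing.Lmodule.copy (mxalg B) ('I_n -> 'I_n -> B).

Implicit Types X Y Z : mxalg B.

Definition mxalg_mul X Y : mxalg B :=
  fun i j => \sum_(k < n) smul (X i k) (Y k j).

Definition mxalg_star X : mxalg B := fun i j => star (X j i).

Let smul_suml (x : B) (F : 'I_n -> B) :
  smul (\sum_k F k) x = \sum_k smul (F k) x.
Proof.
have D y z : smul (y + z) x = smul y x + smul z x.
  by rewrite -[y]scale1r smul_linearl !scale1r.
have s0 : smul 0 x = 0 by apply: (addrI (smul 0 x)); rewrite -D !addr0.
exact: (big_morph (fun y => smul y x) D s0).
Qed.

Let smul_sumr (x : B) (F : 'I_n -> B) :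
  smul x (\sum_k F k) = \sum_k smul x (F k).
Proof.
have D y z : smul x (y + z) = smul x y + smul x z.
  by rewrite -[y]scale1r smul_linearr !scale1r.
have s0 : smul x 0 = 0 by apply: (addrI (smul x 0)); rewrite -D !addr0.
exact: (big_morph (fun y => smul x y) D s0).
Qed.

Let star_sum (F : 'I_n -> B) : star (\sum_k F k) = \sum_k star (F k).
Proof.
have D (y z : B) : star (y + z) = star y + star z.
  by rewrite -[y]scale1r star_linear conjc1 !scale1r.
have s0 : star (0 : B) = 0 by apply: (addrI (star 0)); rewrite -D !addr0.
exact: (big_morph star D s0).
Qed.

Let mxalg_mulA : associative mxalg_mul.
Proof.
move=> X Y Z; apply/funext => i; apply/funext => j; rewrite /mxalg_mul.
under eq_bigr do rewrite smul_sumr.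
rewrite exchange_big /=; apply: eq_bigr => k _; rewrite smul_suml.
by apply: eq_bigr => l _; rewrite smulA.
Qed.

Let mxalg_mul_linearl a X Y Z :
  mxalg_mul (a *: X + Y) Z = a *: mxalg_mul X Z + mxalg_mul Y Z.
Proof.
apply/funext => i; apply/funext => j.
transitivity (a *: \sum_k smul (X i k) (Z k j) + \sum_k smul (Y i k) (Z k j)) => //.
rewrite scaler_sumr -big_split; apply: eq_bigr => k _ /=.
by rewrite -smul_linearl.
Qed.

Let mxalg_mul_linearr a X Y Z :
  mxalg_mul Z (a *: X + Y) = a *: mxalg_mul Z X + mxalg_mul Z Y.
Proof.
apply/funext => i; apply/funext => j.
transitivity (a *: \sum_k smul (Z i k) (X k j) + \sum_k smul (Z i k) (Y k j)) => //.
rewrite scaler_sumr -big_split; apply: eq_bigr => k _ /=.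
by rewrite -smul_linearr.
Qed.

Let mxalg_starK : involutive mxalg_star.
Proof. by move=> X; apply/funext => i; apply/funext => j; exact: starK. Qed.

Let mxalg_star_linear a X Y :
  mxalg_star (a *: X + Y) = (a^*)%C *: mxalg_star X + mxalg_star Y.
Proof. by apply/funext => i; apply/funext => j; exact: star_linear. Qed.

Let mxalg_starM X Y :
  mxalg_star (mxalg_mul X Y) = mxalg_mul (mxalg_star Y) (mxalg_star X).
Proof.
apply/funext => i; apply/funext => j; rewrite /mxalg_star /mxalg_mul star_sum.
by apply: eq_bigr => k _; rewrite starM.
Qed.

HB.instance Definition _ := Lmodule_isStarAlgebra.Build R (mxalg B)
  mxalg_mulA mxalg_mul_linearl mxalg_mul_linearr mxalg_starK mxalg_star_linear
  mxalg_starM.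

End Matrices.

Section Subalgebras.
Variables (R : realType) (B : cstarAlgType R).

Definition norm_closed (A : set B) : Prop :=
  forall b, (forall e : R, 0 < e -> exists2 a, A a & cnorm (b - a) < e) -> A b.

Record operator_subalgebra (A : set B) : Prop := {
  opalg0 : A 0;
  opalg_linear : forall (c : R[i]) x y, A x -> A y -> A (c *: x + y);
  opalg_mul : forall x y, A x -> A y -> A (smul x y);
  opalg_closed : norm_closed A }.

Definition cstar_subalgebra (C : set B) : Prop :=
  operator_subalgebra C /\ forall x, C x -> C (star x).

Definition cstar_generated (A : set B) : set B :=
  [set b | forall C, cstar_subalgebra C -> A `<=` C -> C b].

End Subalgebras.

Section Operators.
Variables (R : realType) (V : preHilbertType R).

(** The elements of [B(V)], as functions. *)
Definition bounded_op : set (V -> V) :=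
  [set T | (forall (a : R[i]) x y, T (a *: x + y) = a *: T x + T y) /\
           exists M : R, forall x, hnorm (T x) <= M * hnorm x].

Definition adjoint_op (S T : V -> V) : Prop :=
  forall x y, inner (S x) y = inner x (T y).

Record von_neumann_algebra (N : set (V -> V)) : Prop := {
  vna_bounded : N `<=` bounded_op;
  vna_id : N id;
  vna_linear : forall (a : R[i]) S T, N S -> N T -> N (a *: S + T);
  vna_comp : forall S T, N S -> N T -> N (S \o T);
  vna_adjoint : forall S T, N S -> bounded_op T -> adjoint_op S T -> N T;
  vna_weakly_closed : forall T, bounded_op T ->
    (forall (s : seq (V * V)) (e : R), 0 < e -> exists2 S, N S &
      forall p, p \in s -> `|inner (T p.1 - S p.1) p.2| < (e%:C)%C) ->
    N T }.

Definition generated_vna (E : set (V -> V)) : set (V -> V) :=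
  [set T | forall N, von_neumann_algebra N -> E `<=` N -> N T].

Variable B : cstarAlgType R.
Implicit Types (psi : B -> V -> V) (A : set B).

Record star_representation psi : Prop := {
  rep_bounded : forall b, bounded_op (psi b);
  rep_linear : forall (a : R[i]) b c, psi (a *: b + c) = a *: psi b + psi c;
  rep_mul : forall b c, psi (smul b c) = psi b \o psi c;
  rep_star : forall b, adjoint_op (psi b) (psi (star b)) }.

Definition nondegenerate_rep psi : Prop :=
  forall (x : V) (e : R), 0 < e ->
    exists s : seq (B * V), hnorm (x - \sum_(p <- s) psi p.1 p.2) < e.

(** [psi^(n)(X)] as an operator on [V^n]. *)
Definition amplification psi n (X : mxalg n B) (v : 'I_n -> V) : 'I_n -> V :=
  fun i => \sum_(j < n) psi (X i j) (v j).

Definition completely_positive psi : Prop :=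
  forall n (Y : mxalg n B) (v : 'I_n -> V),
    0 <= \sum_(i < n) inner (amplification psi (smul (star Y) Y) v i) (v i).

(** [nu] ranges over the C*-norms of [M_n(B)], of which there is exactly one. *)
Definition completely_contractive psi : Prop :=
  forall n (nu : mxalg n B -> R), cstar_norm nu ->
  forall (X : mxalg n B) (v : 'I_n -> V),
    \sum_(i < n) hnorm (amplification psi X v i) ^+ 2 <=
    nu X ^+ 2 * \sum_(i < n) hnorm (v i) ^+ 2.

Record ccp_map psi : Prop := {
  ccp_bounded : forall b, bounded_op (psi b);
  ccp_linear : forall (a : R[i]) b c, psi (a *: b + c) = a *: psi b + psi c;
  ccp_positive : completely_positive psi;
  ccp_contractive : completely_contractive psi }.

Definition unique_extension_property A psi : Prop :=
  unique (fun phi => ccp_map phi /\ forall a, A a -> phi a = psi a) psi.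

End Operators.

HB.mixin Record isTopologicalGroup G & Group G & Topological G := {
  mulg_continuous : continuous (fun p : G * G => (p.1 * p.2)%g);
  invg_continuous : continuous (fun g : G => (g^-1)%g) }.

#[short(type="topologicalGroupType")]
HB.structure Definition TopologicalGroup :=
  {G of Group G & Topological G & isTopologicalGroup G}.

(** [G] pointed at [1], as [g_sigma_algebraType] yields a measurable type only
    over a pointed type. *)
Definition pointed_group (G : topologicalGroupType) : Type := G.
HB.instance Definition _ (G : topologicalGroupType) :=
  Choice.on (pointed_group G).
HB.instance Definition _ (G : topologicalGroupType) :=
  isPointed.Build (pointed_group G) (1%g : G).

Notation borel G := (g_sigma_algebraType (@open G : set (set (pointed_group G)))).

Record cstar_action (R : realType) (G : topologicalGroupType)
    (B : cstarAlgType R) (alpha : G -> B -> B) : Prop := {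
  action1 : forall b, alpha 1%g b = b;
  actionM : forall g h b, alpha (g * h)%g b = alpha g (alpha h b);
  action_linear : forall g (a : R[i]) b c,
    alpha g (a *: b + c) = a *: alpha g b + alpha g c;
  action_mul : forall g b c, alpha g (smul b c) = smul (alpha g b) (alpha g c);
  action_star : forall g b, alpha g (star b) = star (alpha g b);
  action_continuous : forall b g,
    (fun h => cnorm (alpha h b - alpha g b)) @ g --> (0 : R) }.

Record left_haar_measure (R : realType) (G : topologicalGroupType)
    (mu : {measure set (borel G) -> \bar R}) : Prop := {
  haar_neq0 : mu setT <> 0%E;
  haar_compact : forall K : set G, compact K -> (mu K < +oo)%E;
  haar_outer : forall E : set (borel G), measurable E ->
    mu E = ereal_inf [set mu U | U in [set U : set G | open U /\ E `<=` U]];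
  haar_inner : forall U : set G, open U ->
    mu U = ereal_sup [set mu K | K in [set K : set G | compact K /\ K `<=` U]];
  haar_left_invariant : forall (g : G) (E : set (borel G)), measurable E ->
    mu [set (g * x)%g | x in (E : set G)] = mu E }.

Section TensorLinfty.
Variables (R : realType) (G : topologicalGroupType).
Variables (mu : {measure set (borel G) -> \bar R}) (H : hilbertType R).

(** Representatives of [L^\infty(G)]: bounded functions that are Borel on every
    Borel set of finite measure.  As [mu] need not be sigma-finite, this is
    the notion for which [L^\infty(G)] is the dual of [L^1(G)]. *)
Definition Linfty_fct (f : G -> R[i]) : Prop :=
  (exists M : R, forall g, `|f g| <= (M%:C)%C) /\
  forall E : set (borel G), measurable E -> (mu E < +oo)%E ->
    measurable_fun E (fun g : borel G => complex.Re (f g)) /\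
    measurable_fun E (fun g : borel G => complex.Im (f g)).

(** [S] is the operator [(S xi)(g) = F g (xi g)] on [L^2(G; H)]. *)
Definition fiberwise_op (F : G -> H -> H) (S : L2 mu H -> L2 mu H) : Prop :=
  forall xi : L2fun mu H, exists eta : L2fun mu H,
    {ae mu, forall g, eta g = F g (xi g)} /\ S (L2class xi) = L2class eta.

(** The elementary tensors [T \otimes f], under the identification of
    [H \otimes L^2(G)] with [L^2(G; H)]. *)
Definition elementary_tensors : set (L2 mu H -> L2 mu H) :=
  [set S | exists T f, [/\ bounded_op T, Linfty_fct f &
    fiberwise_op (fun g x => f g *: T x) S]].

Definition tensor_Linfty : set (L2 mu H -> L2 mu H) :=
  generated_vna elementary_tensors.

Variables (B : cstarAlgType R) (alpha : G -> B -> B) (pi : B -> H -> H).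

Definition is_pi_alpha (pi_alpha : B -> L2 mu H -> L2 mu H) : Prop :=
  forall b, fiberwise_op (fun g => pi (alpha (g^-1)%g b)) (pi_alpha b).

End TensorLinfty.

Arguments elementary_tensors {R G} mu H _.
Arguments tensor_Linfty {R G} mu H _.

(* Main.v *)
(* The map [b |-> pi (alpha g^-1 b)] is norm continuous in [g], and sections in
   [L2 mu H] live, up to null sets, on countable unions of compact sets; so
   [pi_alpha] is approximated by finite sums of operators [1_W (x) pi b'].

   For uniqueness, compress an extension [psi], translated by [alpha g0], to the
   vectors [x (x) 1_E / mu(E)^(1/2)] and let [E] shrink to [g0].  Every weak limit
   is a ccp map agreeing with [pi] on [A], hence equals [pi].  Thus
   [<psi b (x (x) 1_E), y (x) 1_E>] is [mu E] times
   [<pi (alpha g0^-1 b) x, y>] up to [o(mu E)] near each [g0], and so is the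
   same expression for [pi_alpha b].  Both operators commute with
   multiplication by [1_E], so their difference is determined by the measures
   [E |-> <D (x (x) 1_E), y (x) 1_E>]; these are locally [o(mu)] at each point,
   hence vanish on compact sets by a finite cover, and then by regularity. *)
Require Import Defs.
From mathcomp Require Import all_boot all_order all_algebra.
From mathcomp Require Import all_classical all_reals all_analysis.
From mathcomp Require Import measurable_realfun.
From mathcomp Require Import complex ring lra.

Set Implicit Arguments.
Unset Strict Implicit.
Unset Printing Implicit Defensive.

Import Order.TTheory GRing.Theory Num.Theory.
Import numFieldTopology.Exports numFieldNormedType.Exports.

Local Open Scope classical_set_scope.
Local Open Scope ring_scope.

(* Unlike [raddfD], these do not call for a [simpl], which would unfold inner
   products. *)
Section RealImaginaryParts.
Variable R : realType.
Implicit Types a b : R[i].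

(** As [mu] need not be sigma-finite and [G] need not be metrizable, the argument avoids
    Radon-Nikodym derivatives and differentiation of measures; the estimate o(mu E) near each point,
    finite covers and finite additivity take their place, and limits run along ultrafilters on sets
    shrinking to [g0] instead of sequences. The translation by [alpha g0] is dictated by the fibres:
    near [g0] the operator [pi_alpha (alpha g0 b)] acts like [pi b], and invariance of [A] keeps
    [alpha g0 a] where the extension is known to agree with [pi_alpha]. An extension has no fibres a
    priori. It is therefore probed on vectors x (x) 1_E, and its range condition enters as
    commutation with every multiplication by 1_E, which elementary tensors satisfy and which
    survives passage to the generated von Neumann algebra. Inner products are handled through their
    real parts, so that all integrals and limits are of real functions; imaginary parts are
    recovered by replacing a vector with ['i] times it. *)

Lemma ReD a b : complex.Re (a + b) = complex.Re a + complex.Re b.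
Proof. by case: a; case: b. Qed.

Lemma ReN a : complex.Re (- a) = - complex.Re a.
Proof. by case: a. Qed.

Lemma ReB a b : complex.Re (a - b) = complex.Re a - complex.Re b.
Proof. by rewrite ReD ReN. Qed.

Lemma Re0 : complex.Re (0 : R[i]) = 0. Proof. by []. Qed.

Lemma Re_sum (I : Type) (r : seq I) (F : I -> R[i]) :
  complex.Re (\sum_(i <- r) F i) = \sum_(i <- r) complex.Re (F i).
Proof. exact: (big_morph _ ReD Re0). Qed.

Lemma Im_sum (I : Type) (r : seq I) (F : I -> R[i]) :
  complex.Im (\sum_(i <- r) F i) = \sum_(i <- r) complex.Im (F i).
Proof. by apply: (big_morph (@complex.Im R)) => // -[? ?] []. Qed.

End RealImaginaryParts.

(** * Inner products through their real parts *)

Section InnerProduct.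
Variables (R : realType) (V : preHilbertType R).
Implicit Types (x y z : V).

Lemma ler_norm_Re_inner x y :
  `|complex.Re (inner x y)| <= hnorm x * hnorm y.
Proof.
rewrite ler_norml inner_CS andbT lerNl.
by have := inner_CS (- x) y; rewrite innerNl raddfN Defs.hnormN.
Qed.

(** Testing against [x - x'] itself yields its squared norm, which is real, so real parts already
    separate vectors. *)
Lemma Re_inner_inj x x' :
  (forall y, complex.Re (inner x y) = complex.Re (inner x' y)) -> x = x'.
Proof.
move=> h; apply/eqP; rewrite -subr_eq0; apply/eqP; apply: hnorm_eq0.
apply/eqP; rewrite -sqrf_eq0; apply/eqP.
by rewrite hnorm_sqr innerDl innerNl raddfB /= h subrr.
Qed.

Lemma inner_suml (I : Type) (r : seq I) (F : I -> V) y :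
  inner (\sum_(i <- r) F i) y = \sum_(i <- r) inner (F i) y.
Proof. by apply: (big_morph (inner^~ y)) => [? ?|]; rewrite ?innerDl ?inner0l. Qed.

Lemma inner_sumr (I : Type) (r : seq I) (F : I -> V) y :
  inner y (\sum_(i <- r) F i) = \sum_(i <- r) inner y (F i).
Proof. by apply: (big_morph (inner y)) => [? ?|]; rewrite ?innerDr ?inner0r. Qed.

Lemma hnorm_scale (a : R[i]) x :
  hnorm (a *: x) = Num.sqrt (complex.Re a ^+ 2 + complex.Im a ^+ 2) * hnorm x.
Proof.
apply: (@pexpIrn _ 2%N); rewrite ?nnegrE ?mulr_ge0 ?hnorm_ge0 ?sqrtr_ge0//.
rewrite /= hnormZ_sqr exprMn; congr (_ * _); rewrite sqr_sqrtr//.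
exact: addr_ge0 (sqr_ge0 _) (sqr_ge0 _).
Qed.

Lemma Re_innerZ_real (t : R) x y :
  complex.Re (inner (t%:C%C *: x) y) = t * complex.Re (inner x y).
Proof. by rewrite innerZl; case: (inner x y) => a b /=; ring. Qed.

(** Expand |x - y|^2 >= 0. This form bounds a pairing by squared norms, the quantities that complete
    contractivity controls. *)
Lemma Re_inner_le_sqr x y :
  complex.Re (inner x y) <= 2^-1 * (hnorm x ^+ 2 + hnorm y ^+ 2).
Proof.
by have := sqr_ge0 (hnorm (x - y)); rewrite hnormD_sqr Defs.hnormN innerNr ReN; lra.
Qed.

End InnerProduct.

(* The representing vector minimises [|y|^2 - 2 f y]; the parallelogram law
   makes minimising sequences Cauchy. *)
Lemma riesz_representation (R : realType) (H : hilbertType R) (f : H -> R) (M : R) :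
  (forall x y, f (x + y) = f x + f y) ->
  (forall (t : R) x, f (t%:C%C *: x) = t * f x) ->
  (forall x, f x <= M * hnorm x) ->
  exists z, forall y, complex.Re (inner z y) = f y.
Proof.
move=> fD fZ fM.
pose J y := hnorm y ^+ 2 - 2 * f y.
(* Complete the square: |y|^2 - 2 M |y| >= - M^2. *)
have Jlb y : - M ^+ 2 <= J y.
  by rewrite /J; have := fM y; have := sqr_ge0 (hnorm y - M); lra.
have hJ : has_inf (range J).
  by split; [exists (J 0), 0|exists (- M ^+ 2) => _ [y _ <-]].
set d := inf (range J).
have dJ y : d <= J y by apply: (ge_inf hJ.2); exists y.
(* Parallelogram law, with [J] at the midpoint of [y] and [z] bounded below by [d]. *)
have Jhalf y z : hnorm (y - z) ^+ 2 <= 2 * (J y + J z - 2 * d).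
  have := dJ ((2^-1 : R)%:C%C *: (y + z)).
  rewrite /J hnormZ_real ?invr_ge0// fZ fD exprMn.
  have := hnormD_sqr y z; have := hnormD_sqr y (- z).
  rewrite Defs.hnormN innerNr raddfN /=; lra.
have seqJ n : exists y, J y < d + n.+1%:R^-1.
  have n0 : (0 : R) < n.+1%:R^-1 by rewrite invr_gt0.
  by have [_ [y _ <-] ?] := inf_adherent n0 hJ; exists y.
have [u uJ] := choice seqJ.
have cauchy_u (e : R) : 0 < e -> exists N : nat, forall m n : nat,
    (N <= m)%N -> (N <= n)%N -> hnorm (u m - u n) < e.
  (* By [Jhalf] the squared distance is at most twice the sum of two excesses over [d]; each below
     e^2/4 gives e^2. *)
  move=> e0; have e4 : 0 < e ^+ 2 / 4 by rewrite divr_gt0 ?exprn_gt0.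
  have /cvgrPdist_lt/(_ _ e4) := @cvg_harmonic R; move=> [N _ NP].
  exists N => m n Nm Nn; rewrite -(@ltr_pXn2r _ 2%N) ?nnegrE ?hnorm_ge0 ?ltW//.
  apply: le_lt_trans (Jhalf _ _) _.
  have := NP m Nm; have := NP n Nn; rewrite /= /harmonic !sub0r !normrN.
  rewrite !ger0_norm ?invr_ge0//; have := uJ m; have := uJ n.
  by move: (m.+1%:R^-1) (n.+1%:R^-1) => r s; lra.
have [l ul] := hilbert_complete u cauchy_u.
have fN x : f (- x) = - f x.
  by rewrite -mulN1r -fZ rmorphN1 scaleN1r.
have Jl : J l <= d.
  have fl (x : H) : `|f x| <= M * hnorm x.
    by rewrite ler_norml fM andbT lerNl -fN -[hnorm x]Defs.hnormN fM.
  have uJd : (fun n => d + n.+1%:R^-1) @ \oo --> d.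
    by rewrite -[X in _ --> X]addr0; apply: cvgD; [exact: cvg_cst|exact: cvg_harmonic].
  have Ju : (fun n => J (u n)) @ \oo --> J l.
    have nu : (fun n => hnorm (u n)) @ \oo --> hnorm l.
      apply/cvgrPdist_lt => e e0; move/cvgrPdist_lt/(_ _ e0) : ul.
      apply: filterS => n; rewrite sub0r normrN ger0_norm ?hnorm_ge0//.
      by apply: le_lt_trans; rewrite distrC ler_dist_hnorm.
    have fu : (fun n => f (u n)) @ \oo --> f l.
      have : (fun n => M * hnorm (u n - l)) @ \oo --> (0 : R).
        by rewrite -[X in _ --> X](mulr0 M); apply: cvgMl_tmp.
      move=> Mu; apply/cvgrPdist_lt => e e0; move/cvgrPdist_lt/(_ _ e0) : Mu.
      apply: filterS => n; rewrite sub0r normrN; apply: le_lt_trans.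
      apply: le_trans (ler_norm _); rewrite Defs.hnormB.
      have -> : f l - f (u n) = f (l - u n).
        by rewrite fD fN.
      exact: fl.
    apply: cvgB; first by rewrite expr2; under eq_fun do rewrite expr2; exact: cvgM.
    by apply: cvgMl_tmp.
  apply: (ler_cvg_to Ju uJd); apply: nearW => n; exact/ltW.
exists l => y; apply/eqP; rewrite -subr_eq0; apply/eqP.
(* Half the derivative of [J] at the minimiser [l] in the direction [y]; it has to vanish. *)
set c := _ - _.
have var (t : R) : 0 <= 2 * t * c + t ^+ 2 * hnorm y ^+ 2.
  have := dJ (l + t%:C%C *: y); move/(le_trans Jl).
  rewrite /J hnormD_sqr fD fZ hnormZ_sqr /= expr0n addr0.
  by rewrite (Re_innerC l) Re_innerZ_real (Re_innerC y) /c; lra.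
have [->//|c0] := eqVneq c 0.
(* The variation at t = - c / N equals c^2/N^2 (|y|^2 - 2 N), which is negative; the summand 1
   covers y = 0. *)
pose N := 1 + hnorm y ^+ 2; have N0 : 0 < N by rewrite ltr_pwDl ?sqr_ge0.
have := var (- c / N).
have -> : 2 * (- c / N) * c + (- c / N) ^+ 2 * hnorm y ^+ 2 =
  c ^+ 2 / N ^+ 2 * (hnorm y ^+ 2 - 2 * N) by field; rewrite gt_eqF.
have cN : 0 < c ^+ 2 / N ^+ 2.
  by rewrite divr_gt0 ?(exprn_gt0 2 N0)// lt_def sqrf_eq0 c0 sqr_ge0.
by rewrite (pmulr_rge0 _ cN) /N; have := sqr_ge0 (hnorm y); lra.
Qed.

(** * Bounded operators and completely positive maps *)

Section Operators.
Variables (R : realType) (V : preHilbertType R) (B : cstarAlgType R).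

Lemma bounded_op0 (T : V -> V) : bounded_op T -> T 0 = 0.
Proof.
by move=> [TL _]; have := TL (-1) 0 0; rewrite scaleN1r oppr0 addr0 scaleN1r addNr.
Qed.

Lemma bounded_opD (T : V -> V) x y : bounded_op T -> T (x + y) = T x + T y.
Proof. by move=> [TL _]; have := TL 1 x y; rewrite !scale1r. Qed.

Lemma bounded_opZ (T : V -> V) a x : bounded_op T -> T (a *: x) = a *: T x.
Proof. by move=> bT; have := bT.1 a x 0; rewrite !addr0 (bounded_op0 bT) addr0. Qed.

Lemma bounded_opB (T : V -> V) x y : bounded_op T -> T (x - y) = T x - T y.
Proof. by move=> bT; rewrite bounded_opD// -scaleN1r bounded_opZ// scaleN1r. Qed.

Lemma bounded_op_le (T : V -> V) : bounded_op T ->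
  exists2 M : R, 0 < M & forall x, hnorm (T x) <= M * hnorm x.
Proof.
move=> [_ [M TM]]; exists (`|M| + 1); first by rewrite ltr_wpDl.
by move=> x; apply: le_trans (TM x) _; rewrite ler_wpM2r ?hnorm_ge0// ler_wpDr// ler_norm.
Qed.

Lemma bounded_op_sum (T : V -> V) (I : Type) (r : seq I) (F : I -> V) :
  bounded_op T -> T (\sum_(i <- r) F i) = \sum_(i <- r) T (F i).
Proof.
move=> bT; apply: (big_morph T); last exact: bounded_op0.
by move=> x y; exact: bounded_opD.
Qed.

Lemma linear0_of (psi : B -> V -> V) :
  (forall (a : R[i]) b c, psi (a *: b + c) = a *: psi b + psi c) -> psi 0 = 0.
Proof. by move=> L; have := L (-1) 0 0; rewrite scaleN1r oppr0 addr0 scaleN1r addNr. Qed.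

Lemma linearD_of (psi : B -> V -> V) :
  (forall (a : R[i]) b c, psi (a *: b + c) = a *: psi b + psi c) ->
  forall b c, psi (b + c) = psi b + psi c.
Proof. by move=> L b c; have := L 1 b c; rewrite !scale1r. Qed.

Lemma linearZ_of (psi : B -> V -> V) :
  (forall (a : R[i]) b c, psi (a *: b + c) = a *: psi b + psi c) ->
  forall a b, psi (a *: b) = a *: psi b.
Proof. by move=> L a b; have := L a b 0; rewrite !addr0 (linear0_of L) addr0. Qed.

Lemma linearB_of (psi : B -> V -> V) :
  (forall (a : R[i]) b c, psi (a *: b + c) = a *: psi b + psi c) ->
  forall b c, psi (b - c) = psi b - psi c.
Proof.
by move=> L b c; rewrite (linearD_of L) -scaleN1r (linearZ_of L) scaleN1r.
Qed.

Lemma linear_sum_of (psi : B -> V -> V) :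
  (forall (a : R[i]) b c, psi (a *: b + c) = a *: psi b + psi c) ->
  forall (I : Type) (r : seq I) (F : I -> B) x,
  psi (\sum_(i <- r) F i) x = \sum_(i <- r) psi (F i) x.
Proof.
move=> L I r F x; apply: (big_morph (psi^~ x)).
  by move=> b c; rewrite linearD_of.
by rewrite linear0_of.
Qed.

(** Multiplicativity and the adjoint relation move the factor [star Y] to the other argument,
    turning the form into a sum of squared norms. *)
Lemma star_representation_cp (psi : B -> V -> V) :
  star_representation psi -> completely_positive psi.
Proof.
move=> [bp Lp Mp Sp] n Y v.
pose w k := \sum_(j < n) psi (Y k j) (v j).
suff -> : \sum_(i < n) inner (amplification psi (smul (star Y) Y) v i) (v i) =
    \sum_(k < n) inner (w k) (w k) by apply: sumr_ge0 => k _; exact: inner_ge0.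
rewrite /amplification.
under eq_bigr => i _.
  rewrite inner_suml.
  under eq_bigr => j _.
    rewrite (linear_sum_of Lp) inner_suml.
    under eq_bigr => k _ do rewrite Mp /= Sp starK.
    over.
  rewrite exchange_big /=.
  under eq_bigr => k _ do rewrite -inner_suml.
  over.
rewrite exchange_big /=; apply: eq_bigr => k _.
by rewrite /w inner_sumr.
Qed.

End Operators.

(** * Estimates, convergence and density in [L2] *)

Section L2theory.
Context d (T : measurableType d) (R : realType).
Variables (mu : {measure set T -> \bar R}) (H : preHilbertType R).
Implicit Types (f g xi : L2fun mu H) (E : set T) (x y : H).

Lemma L2class0 : L2class 0 = 0 :> L2 mu H.
Proof. by apply: (addrI (L2class 0)); rewrite -L2classD !addr0. Qed.

Lemma L2class_sum (I : Type) (r : seq I) (F : I -> L2fun mu H) :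
  L2class (\sum_(i <- r) F i) = \sum_(i <- r) L2class (F i).
Proof. exact: (big_morph _ (@L2classD _ T R mu H) L2class0). Qed.

Lemma L2classB f g : L2class (f - g) = L2class f - L2class g.
Proof.
by have := L2class_linear (-1) g f; rewrite !scaleN1r addrC => ->; rewrite addrC.
Qed.

Lemma L2val_sum (I : Type) (r : seq I) (F : I -> L2fun mu H) t :
  (\sum_(i <- r) F i : L2fun mu H) t = \sum_(i <- r) F i t.
Proof. exact: (big_morph (fun f : L2fun mu H => f t)). Qed.

Lemma L2valB f g t : (f - g : L2fun mu H) t = f t - g t. Proof. by []. Qed.

Lemma L2class_scale (a : R[i]) f : L2class (a *: f) = a *: L2class f.
Proof. exact: L2classZ. Qed.

Lemma L2valZ (a : R[i]) f t : (a *: f : L2fun mu H) t = a *: f t. Proof. by []. Qed.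

Lemma inner_L2class f g :
  inner (L2class f) (L2class g) = L2fun_inner mu f g.
Proof. exact: L2inner_class. Qed.

Lemma Re_inner_L2class f g : complex.Re (inner (L2class f) (L2class g)) =
  \int[mu]_t complex.Re (inner (f t) (g t)).
Proof. by rewrite inner_L2class. Qed.

Lemma hnorm_L2class f :
  hnorm (L2class f) ^+ 2 = \int[mu]_t (hnorm (f t) ^+ 2).
Proof.
rewrite hnorm_sqr Re_inner_L2class; apply: eq_Rintegral => t _.
by rewrite hnorm_sqr.
Qed.

Lemma integrable_hnorm_sqr f :
  mu.-integrable setT (EFin \o (fun t => hnorm (f t) ^+ 2)).
Proof. by have /square_integrableP[] := L2funP f. Qed.

Lemma ae_le_Rintegral (u v : T -> R) :
  mu.-integrable setT (EFin \o u) -> mu.-integrable setT (EFin \o v) ->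
  {ae mu, forall t, u t <= v t} -> \int[mu]_t u t <= \int[mu]_t v t.
Proof.
move=> iu iv uv; rewrite -subr_ge0 -RintegralB//.
have mu_ := measurable_int _ iu; have mv := measurable_int _ iv.
(* Passing to the absolute value alters the integrand on a null set and makes it nonnegative
   everywhere. *)
have -> : \int[mu]_t (v t - u t) = \int[mu]_t `|v t - u t|.
  congr fine; apply: ae_eq_integral => //.
  - by apply/measurable_EFinP; apply: measurable_funB; apply/measurable_EFinP.
  - apply/measurable_EFinP; apply: measurableT_comp => //.
    by apply: measurable_funB; apply/measurable_EFinP.
  - by apply: filterS uv => t uv _; rewrite ger0_norm ?subr_ge0.
by apply: Rintegral_ge0.
Qed.

Lemma L2_le (C : R) f g : 0 <= C ->
  {ae mu, forall t, hnorm (f t) <= C * hnorm (g t)} ->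
  hnorm (L2class f) <= C * hnorm (L2class g).
Proof.
move=> C0 fg; rewrite -(@ler_pXn2r _ 2%N) ?nnegrE ?mulr_ge0 ?hnorm_ge0//.
rewrite exprMn !hnorm_L2class -RintegralZl//; last exact: integrable_hnorm_sqr.
apply: ae_le_Rintegral.
- exact: integrable_hnorm_sqr.
- have := integrableZl measurableT (C ^+ 2) (integrable_hnorm_sqr g); exact.
- apply: filterS fg => t fg; rewrite -exprMn.
  by rewrite ler_pXn2r ?nnegrE ?mulr_ge0 ?hnorm_ge0.
Qed.

(** Scalar dominated convergence for |f_n - f|^2, with dominating function C^2 |xi|^2. *)
Lemma L2_dominated_cvg (C : R) (f_ : nat -> L2fun mu H) f xi : 0 <= C ->
  {ae mu, forall t, (fun n => hnorm (f_ n t - f t)) @ \oo --> (0 : R)} ->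
  {ae mu, forall t, forall n, hnorm (f_ n t - f t) <= C * hnorm (xi t)} ->
  (fun n => hnorm (L2class (f_ n) - L2class f)) @ \oo --> (0 : R).
Proof.
move=> C0 f_f f_xi.
suff h : (fun n => hnorm (L2class (f_ n) - L2class f) ^+ 2) @ \oo --> (0 : R).
  apply/cvgrPdist_lt => e e0; have e20 : 0 < e ^+ 2 by rewrite exprn_gt0.
  move/cvgrPdist_lt/(_ _ e20) : h; apply: filterS => n.
  rewrite !sub0r !normrN !ger0_norm ?sqr_ge0 ?hnorm_ge0//.
  by rewrite ltr_pXn2r ?nnegrE ?hnorm_ge0// ltW.
have m_ n : measurable_fun setT (EFin \o (fun t => hnorm (f_ n t - f t) ^+ 2)).
  exact: measurable_int (integrable_hnorm_sqr (f_ n - f)).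
have m0 : measurable_fun [set: T] (cst 0%E : T -> \bar R) by exact: measurable_cst.
have ixi : mu.-integrable setT (EFin \o (fun t => C ^+ 2 * hnorm (xi t) ^+ 2)).
  have := integrableZl measurableT (C ^+ 2) (integrable_hnorm_sqr xi); exact.
have [] := @dominated_convergence _ T R mu setT measurableT
  (fun n t => (hnorm (f_ n t - f t) ^+ 2)%:E) (cst 0%E)
  (EFin \o (fun t => C ^+ 2 * hnorm (xi t) ^+ 2)) m_ m0 _ ixi _.
- apply: filterS f_f => t f_f _; apply: cvg_EFin; first exact: nearW.
  rewrite [X in X @ _](_ : _ = fun n => hnorm (f_ n t - f t) * hnorm (f_ n t - f t)).
    by rewrite -[X in _ --> X](mulr0 (0 : R)); apply: cvgM.
  by apply/funext => n /=; rewrite expr2.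
- apply: filterS f_xi => t f_xi n _ /=; rewrite lee_fin ger0_norm ?sqr_ge0// -exprMn.
  by rewrite ler_pXn2r ?nnegrE ?mulr_ge0 ?hnorm_ge0.
move=> _ _; rewrite integral_cst// mul0e => /fine_cvg /=; apply: cvg_trans.
apply: near_eq_cvg; apply: nearW => n /=.
by rewrite -L2classB hnorm_L2class.
Qed.

Lemma square_integrable_le (C : R) (u : T -> H) xi : strongly_measurable mu u ->
  (forall t, hnorm (u t) <= C * hnorm (xi t)) -> square_integrable mu u.
Proof.
move=> su uxi; apply/square_integrableP; split => //.
have ixi : mu.-integrable setT (EFin \o (fun t => C ^+ 2 * hnorm (xi t) ^+ 2)).
  have := integrableZl measurableT (C ^+ 2) (integrable_hnorm_sqr xi); exact.
apply: le_integrable ixi => //.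
  by apply/measurable_EFinP; apply: measurable_funX; exact: measurable_hnorm su.
move=> t _ /=; rewrite lee_fin -exprMn !normrX lerXn2r ?nnegrE//.
by rewrite ger0_norm ?hnorm_ge0// (le_trans (uxi t))// ler_norm.
Qed.

(** Made total by the default value 0 when the function is not square integrable; hence the
    measurability and finiteness conditions in what follows. *)
Definition indicL2 E x : L2fun mu H :=
  insubd (0 : L2fun mu H) (fun t => (\1_E t : R[i]) *: x).

Lemma simple_square_integrable (s : T -> H) :
  simple_fct mu s -> square_integrable mu s.
Proof.
move=> [l [lm ->]]; elim: l lm => [|p l IH] lm.
  rewrite (_ : (fun=> _) = 0); first exact: square_integrable0.
  by apply/funext => t; rewrite big_nil.
rewrite [X in square_integrable mu X](_ : _ = 1 *: (fun t => (\1_(p.1) t : R[i]) *: p.2) +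
    (fun t => \sum_(q <- l) (\1_(q.1) t : R[i]) *: q.2)); last first.
  by apply/funext => t; rewrite big_cons scale1r.
apply: square_integrableD; last by apply: IH => q ql; apply: lm; rewrite inE ql orbT.
have [mp fp] := lm p (mem_head _ _).
split.
  exists (fun _ t => (\1_(p.1) t : R[i]) *: p.2); split => [_|t].
    exists [:: p]; split => [q|]; first by rewrite inE => /eqP ->.
    by apply/funext => t; rewrite big_seq1.
  by under eq_fun do rewrite subrr hnorm0; exact: cvg_cst.
rewrite [X in (X < _)%E](_ : _ = \int[mu]_t ((hnorm p.2 ^+ 2)%:E * (\1_(p.1) t)%:E))%E.
  rewrite ge0_integralZl// ?lee_fin ?sqr_ge0//; last first.
    by apply/measurable_EFinP; exact: measurable_indic.
  rewrite integral_indic// setIT lte_mul_pinfty ?lee_fin ?sqr_ge0//.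
apply: eq_integral => t _; rewrite !indicE; case: (t \in p.1) => /=.
  by rewrite scale1r mule1.
by rewrite scale0r hnorm0 expr0n mule0.
Qed.

Lemma indicL2E E x t : measurable E -> (mu E < +oo)%E ->
  indicL2 E x t = (\1_E t : R[i]) *: x.
Proof.
move=> mE fE; rewrite /indicL2 insubdK//; apply/L2predP.
apply: simple_square_integrable; exists [:: (E, x)]; split.
  by move=> p; rewrite inE => /eqP ->.
by apply/funext => s; rewrite big_seq1.
Qed.

(* Hidden behind an opaque proof: otherwise unification of distinct indicators
   unfolds the whole construction of [L2]. *)
Fact indicator_key : {f : set T -> H -> L2 mu H |
  forall E x, f E x = L2class (indicL2 E x)}.
Proof. by exists (fun E x => L2class (indicL2 E x)). Qed.

Definition indicator := sval indicator_key.

Lemma indicatorE E x : indicator E x = L2class (indicL2 E x).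
Proof. exact: (svalP indicator_key). Qed.

(** Pointwise approximants [s n] need not be dominated, so each is cut down to the set [C n] where
    |s n| <= 2 |xi|. The result stays within 3 |xi| of [xi]. Where [xi] vanishes this forces
    equality; elsewhere convergence puts the point in [C n] eventually. *)
Lemma simple_dense xi (e : R) : 0 < e -> exists2 l : seq (set T * H),
  (forall p, p \in l -> measurable p.1 /\ (mu p.1 < +oo)%E) &
  hnorm (\sum_(p <- l) indicator p.1 p.2 - L2class xi) < e.
Proof.
move=> e0; have [[s [ss sxi]] _] := L2funP xi.
pose C n := [set t | hnorm (s n t) <= 2 * hnorm (xi t)].
have mC n : measurable (C n).
  have m1 : measurable_fun setT (fun t => 2 * hnorm (xi t)).
    apply: measurable_funM; first exact: measurable_cst.
    by apply: (@measurable_hnorm _ _ _ mu); have [] := L2funP xi.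
  have m2 : measurable_fun setT (fun t => hnorm (s n t)).
    apply: (@measurable_hnorm _ _ _ mu).
    by have [] := simple_square_integrable (ss n).
  have := measurable_fun_le measurableT m2 m1; rewrite setTI; exact.
have /choice[l lP] n : exists l : seq (set T * H),
    (forall p, p \in l -> measurable p.1 /\ (mu p.1 < +oo)%E) /\
    forall t, \sum_(p <- l) (\1_(p.1) t : R[i]) *: p.2 = (\1_(C n) t : R[i]) *: s n t.
  have [l [lm sE]] := ss n; exists [seq (p.1 `&` C n, p.2) | p <- l]; split.
    move=> p /mapP[q /lm[mq fq] ->] /=; split; first exact: measurableI.
    by apply: le_lt_trans fq; apply: le_measure; rewrite ?inE//; exact: measurableI.
  move=> t; rewrite big_map sE scaler_sumr; apply: eq_bigr => p _ /=.
  rewrite scalerA !indicE in_setI mulrC; congr (_ *: _).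
  by case: (t \in _); case: (t \in _); rewrite ?mulr1 ?mulr0.
pose f_ n := \sum_(p <- l n) indicL2 p.1 p.2.
have f_E n t : f_ n t = (\1_(C n) t : R[i]) *: s n t.
  have [lm <-] := lP n; rewrite /f_ L2val_sum big_seq [RHS]big_seq.
  by apply: eq_bigr => p /lm[mp fp]; exact: indicL2E.
have bnd t n : hnorm (f_ n t - xi t) <= 3 * hnorm (xi t).
  rewrite f_E indicE; case: (boolP (t \in C n)) => [|_] /=; last first.
    by rewrite scale0r sub0r Defs.hnormN; have := hnorm_ge0 (xi t); lra.
  rewrite inE /C /= scale1r => h; have := ler_hnormD (s n t) (- xi t); rewrite Defs.hnormN; lra.
have cv t : (fun n => hnorm (f_ n t - xi t)) @ \oo --> (0 : R).
  have [xi0|xi0] := eqVneq (hnorm (xi t)) 0.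
    under eq_fun => n.
      have -> : hnorm (f_ n t - xi t) = 0.
        by apply/eqP; rewrite eq_le hnorm_ge0 andbT; have := bnd t n; rewrite xi0 mulr0.
      over.
    exact: cvg_cst.
  have xi1 : 0 < hnorm (xi t) by rewrite lt_def xi0 hnorm_ge0.
  apply: cvg_trans (sxi t); apply: near_eq_cvg.
  move/cvgrPdist_lt/(_ _ xi1) : (sxi t); apply: filterS => n.
  rewrite sub0r normrN ger0_norm ?hnorm_ge0// => h; rewrite f_E indicE mem_set ?scale1r//.
  by rewrite /C /=; have := ler_hnormD (s n t - xi t) (xi t); rewrite subrK; lra.
have := @L2_dominated_cvg 3 f_ xi xi (ler0n _ _) _ _.
move=> /(_ (nearW _ cv) (nearW _ bnd)) /cvgrPdist_lt /(_ _ e0) [N _ /(_ N (leqnn N))] /=.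
rewrite sub0r normrN ger0_norm ?hnorm_ge0// => h; exists (l N); first by have [] := lP N.
by under eq_bigr do rewrite indicatorE; rewrite -L2class_sum.
Qed.

(** Finite sums of indicators are dense, so vanishing passes to all vectors by continuity, in one
    argument at a time. *)
Lemma bounded_op_indic_eq0 (D : L2 mu H -> L2 mu H) : bounded_op D ->
  (forall E F x y, measurable E -> (mu E < +oo)%E -> measurable F -> (mu F < +oo)%E ->
     complex.Re (inner (D (indicator E x)) (indicator F y)) = 0) ->
  forall u, D u = 0.
Proof.
move=> bD D0 u; have [M M0 DM] := bounded_op_le bD.
apply: Re_inner_inj => v; rewrite inner0l Re0.
suff D1 (l m : seq (set T * H)) :
    (forall p, p \in l -> measurable p.1 /\ (mu p.1 < +oo)%E) ->
    (forall p, p \in m -> measurable p.1 /\ (mu p.1 < +oo)%E) ->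
    complex.Re (inner (D (\sum_(p <- l) indicator p.1 p.2))
                      (\sum_(p <- m) indicator p.1 p.2)) = 0.
  have D2 l : (forall p, p \in l -> measurable p.1 /\ (mu p.1 < +oo)%E) ->
      complex.Re (inner (D (\sum_(p <- l) indicator p.1 p.2)) v) = 0.
    move=> ll; apply/eqP; rewrite -normr_le0; apply/ler_addgt0Pr => e e0; rewrite add0r.
    (* The added 1 keeps the divisor positive when [w] is zero. *)
    set w := D _; have w0 : 0 < hnorm w + 1 by rewrite ltr_wpDl ?hnorm_ge0.
    have [g ->] := L2class_surj v.
    have [m mm h] := simple_dense g (divr_gt0 e0 w0).
    have := D1 l m ll mm; rewrite -/w => wm.
    rewrite -[L2class g](subKr (\sum_(p <- m) indicator p.1 p.2)).
    rewrite innerDr innerNr ReD ReN wm sub0r normrN.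
    apply: le_trans (ler_norm_Re_inner _ _) _.
    have /ltW := h; rewrite ler_pdivlMr// => h'; apply: le_trans h'.
    by rewrite mulrC ler_wpM2l ?hnorm_ge0// lerDl.
  apply/eqP; rewrite -normr_le0; apply/ler_addgt0Pr => e e0; rewrite add0r.
  have v0 : 0 < M * (hnorm v + 1) by rewrite mulr_gt0// ltr_wpDl ?hnorm_ge0.
  have [g ->] := L2class_surj u.
  have [l ll h] := simple_dense g (divr_gt0 e0 v0).
  rewrite -[L2class g](subKr (\sum_(p <- l) indicator p.1 p.2)).
  rewrite bounded_opD// innerDl ReD D2// add0r.
  apply: le_trans (ler_norm_Re_inner _ _) _.
  have /ltW := h; rewrite ler_pdivlMr// => h'; apply: le_trans h'.
  apply: le_trans (ler_wpM2r (hnorm_ge0 _) (DM _)) _.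
  rewrite Defs.hnormN mulrCA -mulrA ler_wpM2l ?(ltW M0)//.
  by rewrite ler_wpM2l ?hnorm_ge0// lerDl.
move=> ll mm; rewrite bounded_op_sum// inner_suml Re_sum big_seq big1// => p /ll[mp fp].
rewrite inner_sumr Re_sum big_seq big1// => q /mm[mq fq].
exact: D0.
Qed.

End L2theory.

(** * Finite covers and disjoint refinements *)

(** The near-covering form of compactness is applied to finite lists directed by inclusion: a
    property holds eventually when it holds for all lists containing some fixed one. *)
Lemma compact_finite_cover (X : topologicalType) (K : set X) (V : X -> set X) :
  compact K -> (forall x, K x -> nbhs x (V x)) ->
  exists l : seq X, forall g, K g -> exists2 c, c \in l & V c g.
Proof.
move=> /compact_near_coveringP cK KV.
pose F : set_system (seq X) :=
  filter_from setT (fun l0 : seq X => [set l : seq X | {subset l0 <= l}]).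
have FF : Filter F.
  apply: filter_fromT_filter; first by exists [::].
  move=> l1 l2; exists (l1 ++ l2) => l h.
  by split => x xl; apply: h; rewrite mem_cat xl ?orbT.
have [|l0 _ lP] := cK _ F (fun l g => exists2 c, c \in l & V c g) FF.
  move=> x Kx; exists (V x, [set l : seq X | x \in l]); first split.
  - exact: KV.
  - by exists [:: x] => // l /(_ x (mem_head _ _)).
  - by move=> [g l] /= [Vxg xl]; exists x.
by exists l0; apply: lP.
Qed.

(** Each set loses what earlier ones cover, so at [t] the sum selects the value attached to the
    first set containing [t], or 0. The refined list does not depend on [F], so one partition serves
    all vectors; [Q] will be measurability. *)
Lemma disjoint_step (T : Type) (I : choiceType) (l : seq (set T * I)) :
  exists l' : seq (set T * I),
    (forall Q : set T -> Prop, (forall A B, Q A -> Q B -> Q (A `\` B)) ->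
       (forall p, p \in l -> Q p.1) -> forall p, p \in l' -> Q p.1) /\
    forall (R : realType) (V : lmodType R[i]) (F : I -> V) t,
      (exists2 p, p \in l & p.1 t /\
         \sum_(q <- l') (\1_(q.1) t : R[i]) *: F q.2 = F p.2) \/
      (forall p, p \in l -> ~ p.1 t) /\
         \sum_(q <- l') (\1_(q.1) t : R[i]) *: F q.2 = 0.
Proof.
elim: l => [|[W c] l [l' [l'Q l'P]]].
  exists [::]; split=> // R V F t; right; split => //; by rewrite big_nil.
exists ((W, c) :: [seq (p.1 `\` W, p.2) | p <- l']); split.
  move=> Q QD Ql p; rewrite inE => /orP[/eqP ->|/mapP[q ql' ->]].
    by apply: (Ql (W, c)); rewrite mem_head.
  apply: (QD); last by apply: (Ql (W, c)); rewrite mem_head.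
  by apply: (l'Q Q QD _ q ql') => r rl; apply: Ql; rewrite inE rl orbT.
move=> R V F t; rewrite big_cons big_map /=.
have [Wt|nWt] := pselect (W t).
  left; exists (W, c); first exact: mem_head.
  split => //=; rewrite indicE mem_set// scale1r big1 ?addr0// => p _.
  by rewrite indicE memNset ?scale0r// => -[].
rewrite indicE memNset// scale0r add0r.
under eq_bigr => p _.
  rewrite (_ : \1_(p.1 `\` W) t = \1_(p.1) t); last first.
    by rewrite !indicE in_setD (memNset nWt) andbT.
  over.
case: (l'P R V F t) => [[p pl pt]|[h1 h2]].
  by left; exists p => //; rewrite inE pl orbT.
right; split => // p; rewrite inE => /orP[/eqP -> //|]; exact: h1.
Qed.

(** * Regularity of Haar measure and compact exhaustions *)

Section BorelGroup.
Variables (R : realType) (G : topologicalGroupType).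
Variables (mu : {measure set (borel G) -> \bar R}).
Hypotheses (G_hausdorff : hausdorff_space G) (mu_haar : left_haar_measure mu).

Lemma borel_open (U : set G) : open U -> measurable (U : set (borel G)).
Proof. by move=> oU; apply: sub_sigma_algebra. Qed.

Lemma borel_closed (U : set G) : closed U -> measurable (U : set (borel G)).
Proof.
move=> cU; rewrite -[U]setCK; apply: measurableC; apply: borel_open.
exact: closed_openC.
Qed.

Lemma borel_compact (K : set G) : compact K -> measurable (K : set (borel G)).
Proof. by move=> cK; apply: borel_closed; exact: compact_closed. Qed.

(** A form of sigma-compactness modulo null sets. Membership for all large indices, rather than in
    the union, is what pointwise limits along the same index require. *)
Definition ae_exhausted (S : set G) := exists L : nat -> set G,
  (forall n, compact (L n)) /\
  {ae mu, forall g : borel G, S g -> exists N, forall n, (N <= n)%N -> L n g}.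

Lemma compact_exhaustion2 (K : nat -> nat -> set G) :
  (forall i j, compact (K i j)) -> exists L : nat -> set G,
  (forall n, compact (L n)) /\
  forall g i j, K i j g -> exists N, forall n, (N <= n)%N -> L n g.
Proof.
move=> cK.
exists (fun n => \big[setU/set0]_(i < n) \big[setU/set0]_(j < n) K i j); split.
  by move=> n; apply: bigsetU_compact => i _; apply: bigsetU_compact => j _.
(* The [n]-th union runs over indices strictly below [n], hence the successor. *)
move=> g i j Kg; exists (maxn i j).+1 => n; rewrite gtn_max => /andP[iN jN].
rewrite -(bigcup_mkord n (fun i => \big[setU/set0]_(j < n) K i j)).
exists i => //; rewrite -(bigcup_mkord n (K i)); by exists j.
Qed.

Lemma ae_exhausted_bigcup (S : nat -> set G) :
  (forall n, ae_exhausted (S n)) -> ae_exhausted (\bigcup_n S n).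
Proof.
move=> /choice[K KP].
have [L [cL LP]] := compact_exhaustion2 (fun i j => (KP i).1 j).
exists L; split => //.
have : {ae mu, forall g : borel G, forall n, S n g ->
    exists N, forall m, (N <= m)%N -> K n m g}.
  by apply/ae_foralln => n; exact: (KP n).2.
apply: filterS => g h [n _ Sg]; have [N NP] := h n Sg.
exact: LP (NP N (leqnn N)).
Qed.

Lemma ae_exhaustedS (S S' : set G) :
  S `<=` S' -> ae_exhausted S' -> ae_exhausted S.
Proof.
move=> SS' [L [cL LP]]; exists L; split => //.
by apply: filterS LP => g h /SS'; exact: h.
Qed.

Lemma exists_open_finite (E : set (borel G)) : measurable E -> (mu E < +oo)%E ->
  exists U : set G, [/\ open U, E `<=` U & (mu U < +oo)%E].
Proof.
move=> mE; rewrite (haar_outer mu_haar mE) => /ereal_inf_lt[_ [U [oU EU] <-] ?].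
by exists U.
Qed.

Lemma exists_compact_approx (U : set G) (e : R) : open U -> (mu U < +oo)%E -> 0 < e ->
  exists K : set G, [/\ compact K, K `<=` U & (mu (U `\` K) <= e%:E)%E].
Proof.
move=> oU fU e0; have mU := borel_open oU.
have fin : mu U \is a fin_num by rewrite ge0_fin_numE.
have fin_sup := fin; rewrite (haar_inner mu_haar oU) in fin_sup.
have [_ [K [cK KU] <-]] := ub_ereal_sup_adherent e0 fin_sup.
rewrite -(haar_inner mu_haar oU) => h.
have mK := borel_compact cK.
exists K; split => //; rewrite measureD// (setIidr KU).
have fK : mu K \is a fin_num.
  by rewrite ge0_fin_numE//; exact: (haar_compact mu_haar cK).
move: h; rewrite -[X in (X - _ <= _)%E](fineK fin) -[X in (_ - X <= _)%E](fineK fK).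
rewrite -[X in (X - _ < _)%E](fineK fin) -[X in (_ < X)%E](fineK fK).
by rewrite -!EFinB lte_fin lee_fin; lra.
Qed.

(** Inner regularity is assumed for open sets, so [E] is first enclosed in an open [U] of finite
    measure. Compact subsets of [U] missing measure at most 1/(n+1) have a union that is conull in
    [U]. *)
Lemma ae_exhausted_finite (E : set (borel G)) :
  measurable E -> (mu E < +oo)%E -> ae_exhausted E.
Proof.
move=> mE fE; have [U [oU EU fU]] := exists_open_finite mE fE.
apply: (ae_exhaustedS EU).
have /choice[K KP] n : exists K : set G,
    [/\ compact K, K `<=` U & (mu (U `\` K) <= (n.+1%:R^-1)%:E)%E].
  by apply: exists_compact_approx => //; rewrite invr_gt0.
have [L [cL LP]] := @compact_exhaustion2 (fun i _ => K i)
   (fun i _ => let: And3 c _ _ := KP i in c).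
exists L; split => //.
pose N : set (borel G) := U `\` \bigcup_n K n.
have mK n : measurable (K n : set (borel G)).
  by apply: borel_compact; have [] := KP n.
have mN : measurable N.
  by apply: measurableD; [exact: borel_open|exact: bigcup_measurable].
exists N; split => //.
  apply/eqP; rewrite eq_le measure_ge0 andbT; apply/lee_addgt0Pr => e e0.
  rewrite add0e; have /cvgrPdist_lt/(_ _ e0) := @cvg_harmonic R.
  move=> [n _ /(_ n (leqnn n))]; rewrite /= sub0r normrN ger0_norm ?invr_ge0// => ne.
  have [_ _ h] := KP n; apply: (@le_trans _ _ (mu (U `\` K n))).
    apply: le_measure; rewrite ?inE//.
      by apply: measurableD => //; exact: borel_open.
    by move=> g [Ug nK]; split => // Kg; apply: nK; exists n.
  by apply: le_trans h _; rewrite lee_fin ltW.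
move=> g /=; apply: contra_notP => ngN Ug.
have [n _ Kg] : (\bigcup_n K n) g by apply: contrapT => nK; apply: ngN.
exact: LP n 0%N Kg.
Qed.

(** A pointwise limit of simple functions vanishes off the union of their supports, and each of
    these has finite measure. *)
Lemma ae_exhausted_support (H : preHilbertType R) (xi : L2fun mu H) :
  ae_exhausted [set g | xi g <> 0].
Proof.
have [[s [ss sxi]] _] := L2funP xi.
apply: (@ae_exhaustedS _ (\bigcup_n [set g | s n g <> 0])).
  move=> g /= xg; apply: contrapT => ns; apply: xg; apply: hnorm_eq0.
  have := sxi g; under eq_fun => n.
    have -> : s n g = 0 by apply: contrapT => h; apply: ns; exists n.
    rewrite sub0r Defs.hnormN; over.
  by move/cvg_lim => <- //; rewrite lim_cst.
apply: ae_exhausted_bigcup => n; have [l [lm ->]] := ss n.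
apply: (@ae_exhaustedS _ (\big[setU/set0]_(p <- l) p.1)).
  move=> g /= h; apply: contrapT => nl; apply: h; rewrite big_seq big1// => p pl.
  rewrite indicE memNset ?scale0r// => pg; apply: nl.
  by rewrite (big_rem p pl); left.
have [mS fS] : measurable (\big[setU/set0]_(p <- l) p.1 : set (borel G)) /\
   (mu (\big[setU/set0]_(p <- l) p.1) < +oo)%E.
  elim: l lm {n} => [|p l IH] lm; first by rewrite big_nil measure0.
  have [mp fp] := lm p (mem_head _ _).
  have [|ml fl] := IH; first by move=> q ql; apply: lm; rewrite inE ql orbT.
  rewrite big_cons; split; first exact: measurableU.
  by apply: le_lt_trans (measureU2 mu mp ml) _; rewrite lte_add_pinfty.
exact: ae_exhausted_finite.
Qed.

Lemma ae_exhausted_supports (H : preHilbertType R) (s : seq (L2fun mu H)) :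
  ae_exhausted [set g | exists2 xi, xi \in s & xi g <> 0].
Proof.
(* Beyond the end of the list [nth] returns 0, whose support is empty. *)
apply: (@ae_exhaustedS _ (\bigcup_n [set g | nth 0 s n g <> 0])).
  by move=> g [xi xis h]; exists (index xi s) => //=; rewrite nth_index.
by apply: ae_exhausted_bigcup => n; exact: ae_exhausted_support.
Qed.

End BorelGroup.

(** * Operators given by fibres *)

Section Fiberwise.
Variables (R : realType) (G : topologicalGroupType).
Variables (mu : {measure set (borel G) -> \bar R}) (H : hilbertType R).
Implicit Types (F : G -> H -> H) (S : L2 mu H -> L2 mu H) (xi : L2fun mu H).

(** The operator is computed on a chosen representative; as fibres act pointwise, another
    representative changes the result on a null set. *)
Lemma fiberwise_exists F :
  (forall xi, exists eta : L2fun mu H, {ae mu, forall g, eta g = F g (xi g)}) ->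
  exists S, fiberwise_op F S.
Proof.
move=> /choice[f fP]; exists (fun u => L2class (f (repr u))) => xi.
exists (f (repr (L2class xi))); split => //.
by apply: filterS2 (fP (repr (L2class xi))) (ae_repr xi) => g -> ->.
Qed.

Lemma fiberwise_class F S xi (eta : L2fun mu H) : fiberwise_op F S ->
  {ae mu, forall g, eta g = F g (xi g)} -> S (L2class xi) = L2class eta.
Proof.
move=> FS h; have [eta' [h' ->]] := FS xi; apply/L2class_eq.
by apply: filterS2 h h' => g -> ->.
Qed.

(** Reduces identities between operators to identities between fibres; linearity and
    multiplicativity of [pi_alpha] are obtained this way. *)
Lemma fiberwise_unique F S S' :
  fiberwise_op F S -> fiberwise_op F S' -> S = S'.
Proof.
move=> FS FS'; apply/funext => u; have [xi ->] := L2class_surj u.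
by have [eta [h ->]] := FS xi; rewrite (fiberwise_class FS' h).
Qed.

Lemma fiberwise_ext F F' S :
  (forall g x, F g x = F' g x) -> fiberwise_op F S -> fiberwise_op F' S.
Proof.
by move=> FF' FS xi; have [eta [h ?]] := FS xi; exists eta; split => //;
  apply: filterS h => g ->.
Qed.

Lemma fiberwise_comp F F' S S' : fiberwise_op F S -> fiberwise_op F' S' ->
  fiberwise_op (fun g x => F g (F' g x)) (S \o S').
Proof.
move=> FS FS' xi; have [eta [h E]] := FS' xi; have [zeta [k E']] := FS eta.
by exists zeta; split; [apply: filterS2 h k => g <- | rewrite /= E].
Qed.

Lemma fiberwise_linear a F F' S S' : fiberwise_op F S -> fiberwise_op F' S' ->
  fiberwise_op (fun g x => a *: F g x + F' g x) (a *: S + S').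
Proof.
move=> FS FS' xi; have [eta [h E]] := FS xi; have [eta' [h' E']] := FS' xi.
exists (a *: eta + eta'); split; first by apply: filterS2 h h' => g <- <-.
by rewrite L2class_linear -E -E'.
Qed.

Lemma fiberwise0 : fiberwise_op (fun _ _ => 0) (0 : L2 mu H -> L2 mu H).
Proof.
move=> xi; exists 0; split; first exact: nearW.
by rewrite L2class0.
Qed.

Lemma fiberwise_bounded F S (C : R) : 0 <= C -> fiberwise_op F S ->
  (forall g (a : R[i]) x y, F g (a *: x + y) = a *: F g x + F g y) ->
  (forall g x, hnorm (F g x) <= C * hnorm x) -> bounded_op S.
Proof.
move=> C0 FS FL FC; split.
  move=> a u v; have [xi ->] := L2class_surj u; have [zeta ->] := L2class_surj v.
  have [eta [h ->]] := FS xi; have [eta' [h' ->]] := FS zeta.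
  rewrite -!L2class_linear; apply: (fiberwise_class FS).
  by apply: filterS2 h h' => g h h'; rewrite !L2valP h h' FL.
exists C => u; have [xi ->] := L2class_surj u; have [eta [h ->]] := FS xi.
by apply: L2_le => //; apply: filterS h => g ->.
Qed.

Lemma fiberwise_adjoint F F' S S' : fiberwise_op F S -> fiberwise_op F' S' ->
  (forall g x y, inner (F g x) y = inner x (F' g y)) -> adjoint_op S S'.
Proof.
move=> FS FS' FF' u v.
have [xi ->] := L2class_surj u; have [zeta ->] := L2class_surj v.
have [eta [h ->]] := FS xi; have [eta' [h' ->]] := FS' zeta.
have ReE (xi1 eta1 zeta1 eta1' : L2fun mu H) :
    {ae mu, forall g, inner (eta1 g) (zeta1 g) = inner (xi1 g) (eta1' g)} ->
    complex.Re (inner (L2class eta1) (L2class zeta1)) =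
    complex.Re (inner (L2class xi1) (L2class eta1')).
  move=> k; rewrite !Re_inner_L2class.
  by apply/eqP; rewrite eq_le; apply/andP; split; apply: ae_le_Rintegral;
    try exact: integrable_Re; apply: filterS k => g ->.
have k : {ae mu, forall g, inner (eta g) (zeta g) = inner (xi g) (eta' g)}.
  by apply: filterS2 h h' => g -> ->.
apply/eqP; rewrite eq_complex; apply/andP; split; apply/eqP; first exact: ReE.
(* The imaginary part is the real part against ['i] times the second argument, so [ReE] applies
   again. *)
rewrite !Im_inner -!L2class_scale; apply: ReE; apply: filterS k => g.
by rewrite !L2valZ !innerZr => ->.
Qed.

End Fiberwise.

(** * C*-norms and the group action *)

(** Complete contractivity may be tested on any C*-norm; this produces such norms from known ones,
    on 1 by 1 matrices and twisted by [alpha g]. Completeness travels back through the inverse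
    [T']. *)
Lemma cstar_norm_transport (R : realType) (B1 B2 : starAlgType R)
    (T : B1 -> B2) (T' : B2 -> B1) (nu : B2 -> R) :
  cancel T T' -> cancel T' T ->
  (forall (a : R[i]) x y, T (a *: x + y) = a *: T x + T y) ->
  (forall x y, T (smul x y) = smul (T x) (T y)) ->
  (forall x, T (star x) = star (T x)) ->
  cstar_norm nu -> cstar_norm (nu \o T).
Proof.
move=> TK T'K TL TM TS [n0 nZ nD nM nS nC].
have T0 : T 0 = 0.
  by have := TL (-1) 0 0; rewrite scaleN1r oppr0 addr0 scaleN1r addNr.
have TD x y : T (x + y) = T x + T y by have := TL 1 x y; rewrite !scale1r.
have TZ a x : T (a *: x) = a *: T x by have := TL a x 0; rewrite !addr0 T0 addr0.
have TB x y : T (x - y) = T x - T y by rewrite TD -scaleN1r TZ scaleN1r.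
split => /=.
- by move=> x /n0 h; rewrite -(TK x) h -T0 TK.
- by move=> a x; rewrite TZ nZ.
- by move=> x y; rewrite TD nD.
- by move=> x y; rewrite TM nM.
- by move=> x; rewrite TM TS nS.
move=> u uC; have [|l ul] := nC (T \o u).
  by move=> e /uC[N NP]; exists N => m n /NP h /h; rewrite /= TB.
exists (T' l); apply: cvg_trans ul; apply: near_eq_cvg; apply: nearW => n /=.
by rewrite TB T'K.
Qed.

Lemma cstar_norm_mx1 (R : realType) (B : starAlgType R) (nu : B -> R) :
  cstar_norm nu -> cstar_norm (fun X : mxalg 1 B => nu (X ord0 ord0)).
Proof.
apply: (@cstar_norm_transport R (mxalg 1 B) B (fun X => X ord0 ord0)
  (fun b _ _ => b)) => //.
  by move=> X; apply/funext => i; apply/funext => j; rewrite !ord1.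
by move=> X Y; rewrite [LHS]big_ord1.
Qed.

Lemma cnorm_ge0 (R : realType) (B : cstarAlgType R) (b : B) : 0 <= cnorm b.
Proof.
have [n0 nZ nD _ _ _] := cnormP (s := B).
have := nD b (- b); rewrite subrr.
have z : cnorm (0 : B) = 0 by have := nZ 0 0; rewrite scaler0 normr0 mul0r => -[].
have -> : cnorm (- b) = cnorm b.
  by have := nZ (-1) b; rewrite scaleN1r normrN1 mul1r => -[].
by rewrite z; lra.
Qed.

Section Action.
Variables (R : realType) (G : topologicalGroupType) (B : cstarAlgType R).
Variables (alpha : G -> B -> B).
Hypothesis alpha_action : cstar_action alpha.

Lemma actionK g : cancel (alpha g) (alpha (g^-1)%g).
Proof. by move=> b; rewrite -(actionM alpha_action) mulVg (action1 alpha_action). Qed.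

Lemma actionVK g : cancel (alpha (g^-1)%g) (alpha g).
Proof. by move=> b; rewrite -(actionM alpha_action) mulgV (action1 alpha_action). Qed.

Definition mxact n g (X : mxalg n B) : mxalg n B := fun i j => alpha g (X i j).

Lemma action0 g : alpha g 0 = 0.
Proof.
by have := action_linear alpha_action g (-1) 0 0;
  rewrite scaleN1r oppr0 addr0 scaleN1r addNr.
Qed.

Lemma action_sum g (I : Type) (r : seq I) (f : I -> B) :
  alpha g (\sum_(i <- r) f i) = \sum_(i <- r) alpha g (f i).
Proof.
apply: (big_morph (alpha g)); last exact: action0.
by move=> x y; have := action_linear alpha_action g 1 x y; rewrite !scale1r.
Qed.

Lemma mxact_mul n g (X Y : mxalg n B) :
  mxact g (smul X Y) = smul (mxact g X) (mxact g Y).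
Proof.
apply/funext => i; apply/funext => j; rewrite /mxact [smul X Y _ _]/smul /=.
rewrite [LHS]action_sum; apply: eq_bigr => k _; exact: (action_mul alpha_action).
Qed.

Lemma mxact_star n g (X : mxalg n B) : mxact g (star X) = star (mxact g X).
Proof.
by apply/funext => i; apply/funext => j; exact: (action_star alpha_action).
Qed.

Lemma cstar_norm_mxact n g (nu : mxalg n B -> R) :
  cstar_norm nu -> cstar_norm (nu \o mxact g).
Proof.
apply: (@cstar_norm_transport R _ _ _ (mxact (g^-1)%g)).
- by move=> X; apply/funext => i; apply/funext => j; exact: actionK.
- by move=> X; apply/funext => i; apply/funext => j; exact: actionVK.
- by move=> a X Y; apply/funext => i; apply/funext => j; exact: (action_linear alpha_action).
- exact: mxact_mul.
- exact: mxact_star.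
Qed.

(* Complete contractivity holds with respect to every C*-norm, in particular
   with respect to [b |-> cnorm (alpha g b)]; this replaces the fact that
   automorphisms are isometric. *)
Lemma ccp_le_action (V : preHilbertType R) (psi : B -> V -> V) g b x :
  ccp_map psi -> hnorm (psi b x) <= cnorm (alpha g b) * hnorm x.
Proof.
move=> [_ _ _ cc].
have := cc 1%N _ (cstar_norm_mxact g (cstar_norm_mx1 (cnormP (s := B)))).
move=> /(_ (fun _ _ => b) (fun _ => x)); rewrite !big_ord1 /= /mxact.
rewrite /amplification big_ord1 -exprMn.
by rewrite ler_pXn2r ?nnegrE ?mulr_ge0 ?cnorm_ge0 ?hnorm_ge0.
Qed.

Lemma ccp_le (V : preHilbertType R) (psi : B -> V -> V) b x :
  ccp_map psi -> hnorm (psi b x) <= cnorm b * hnorm x.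
Proof.
by move=> h; have := ccp_le_action 1%g b x h; rewrite (action1 alpha_action).
Qed.

(** Point-norm continuity at [g^-1], pulled back along the continuous inversion. *)
Lemma action_near b g (e : R) : 0 < e ->
  \forall h \near g, cnorm (alpha (h^-1)%g b - alpha (g^-1)%g b) < e.
Proof.
move=> e0; have /cvgrPdist_lt/(_ _ e0) := action_continuous alpha_action b (g^-1)%g.
move=> k; have := @invg_continuous G g _ k; rewrite /nbhs /=; apply: filterS => h /=.
by rewrite sub0r normrN; apply: le_lt_trans; rewrite ler_norm.
Qed.

End Action.

(** * Stability of simple functions *)

Section SimpleFunctions.
Context d (T : measurableType d) (R : realType).
Variables (mu : {measure set T -> \bar R}) (H : preHilbertType R).

Lemma simple_fct0 : simple_fct mu (0 : T -> H).
Proof. by exists [::]; split => //; apply/funext => t; rewrite big_nil. Qed.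

Lemma simple_fct_sum (I : Type) (r : seq I) (P : pred I) (s : I -> T -> H) :
  (forall i, P i -> simple_fct mu (s i)) ->
  simple_fct mu (fun t => \sum_(i <- r | P i) s i t).
Proof.
move=> ss; elim: r => [|i r IH].
  by under eq_fun do rewrite big_nil; exact: simple_fct0.
under eq_fun do rewrite big_cons.
have [Pi|//] := boolP (P i).
by have := simple_fctD 1 (ss i Pi) IH; rewrite scale1r.
Qed.

Lemma simple_fct_elementary (W : set T) (D : H -> H) (s : T -> H) :
  measurable W -> bounded_op D -> simple_fct mu s ->
  simple_fct mu (fun t => (\1_W t : R[i]) *: D (s t)).
Proof.
move=> mW bD [l [lm ->]]; exists [seq (W `&` p.1, D p.2) | p <- l]; split.
  move=> p /mapP[q /lm[mq fq] ->] /=; split; first exact: measurableI.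
  by apply: le_lt_trans fq; apply: le_measure; rewrite ?inE//; exact: measurableI.
apply/funext => t; rewrite bounded_op_sum// scaler_sumr big_map.
apply: eq_bigr => p _ /=; rewrite bounded_opZ// scalerA !indicE in_setI.
by congr (_ *: _); case: (t \in W); case: (t \in p.1); rewrite ?mulr1 ?mulr0.
Qed.

End SimpleFunctions.

(** * Construction of [pi_alpha] *)

Section PiAlpha.
Variables (R : realType) (G : topologicalGroupType).
Variables (mu : {measure set (borel G) -> \bar R}).
Hypotheses (G_hausdorff : hausdorff_space G) (mu_haar : left_haar_measure mu).
Variables (B : cstarAlgType R) (alpha : G -> B -> B).
Hypothesis alpha_action : cstar_action alpha.
Variables (H : hilbertType R) (pi : B -> H -> H).
Hypotheses (pi_rep : star_representation pi) (pi_ccp : ccp_map pi).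
Implicit Types (b : B) (g : G) (xi : L2fun mu H).

Local Notation fiber b := (fun g => pi (alpha (g^-1)%g b)).

(** The norm twisted by [g] takes the value [cnorm b] at [alpha g^-1 b], so the bound is uniform in
    [g]. *)
Lemma fiber_le b g x : hnorm (fiber b g x) <= cnorm b * hnorm x.
Proof.
by have := ccp_le_action alpha_action g (alpha (g^-1)%g b) x pi_ccp;
  rewrite (actionVK alpha_action).
Qed.

(** The operator D (x) 1_W. The set [W] may have infinite measure, since 1_W is bounded and
    Borel. *)
Lemma elementary_exists (W : set (borel G)) (D : H -> H) :
  measurable W -> bounded_op D ->
  exists S, elementary_tensors mu H S /\
    fiberwise_op (fun g x => (\1_W g : R[i]) *: D x) S.
Proof.
move=> mW bD; have [M M0 DM] := bounded_op_le bD.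
have WD g x : hnorm ((\1_W g : R[i]) *: D x) <= M * hnorm x.
  rewrite indicE; case: (g \in W) => /=; rewrite ?scale1r// scale0r hnorm0.
  by rewrite mulr_ge0 ?hnorm_ge0 ?(ltW M0).
have [|S SP] := @fiberwise_exists R G mu H (fun g x => (\1_W g : R[i]) *: D x).
  move=> xi; have [[s [ss sxi]] _] := L2funP xi.
  have sq : square_integrable mu (fun g => (\1_W g : R[i]) *: D (xi g)).
    apply: (@square_integrable_le _ _ _ mu H M _ xi) => //.
    exists (fun n g => (\1_W g : R[i]) *: D (s n g)); split => [n|g].
      exact: simple_fct_elementary.
    apply: (@cvg0_squeeze _ _ (fun n => M * hnorm (s n g - xi g))).
      move=> n; rewrite hnorm_ge0 /= -scalerBr -bounded_opB//.
      by rewrite -/(_ - _) WD.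
    by rewrite -[X in _ --> X](mulr0 M); apply: cvgMl_tmp.
  have sqP : (fun g => (\1_W g : R[i]) *: D (xi g)) \in @L2pred _ (borel G) R mu H by apply/L2predP.
  by exists (MkL2fun sqP); exact: nearW.
exists S; split => //; exists D, (fun g => \1_W g); split => //; split.
  exists 1 => g; rewrite indicE; case: (g \in W) => /=; rewrite ?normr1 ?normr0//.
move=> E mE _; split.
  apply: (@measurable_funS _ _ _ _ setT) => //.
  rewrite [X in measurable_fun _ X](_ : _ = (\1_W : borel G -> R)); first exact: measurable_indic.
  by apply/funext => g; rewrite !indicE; case: (g \in W).
rewrite [X in measurable_fun _ X](_ : _ = cst 0); first exact: measurable_cst.
by apply/funext => g; rewrite !indicE; case: (g \in W).
Qed.

(** Finitely many open sets on which [alpha g^-1 b] moves by less than [e] cover [K]; made disjoint,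
    they let the sum take the value of a single fibre, or 0. Hence the bound by [cnorm b] holds off
    [K] too, as domination will require. *)
Lemma step_exists b (K : set G) (e : R) : compact K -> 0 < e ->
  exists l : seq (set (borel G) * G), (forall p, p \in l -> measurable p.1) /\
    forall g x, let s := \sum_(p <- l) (\1_(p.1) g : R[i]) *: fiber b p.2 x in
      hnorm s <= cnorm b * hnorm x /\ (K g -> hnorm (s - fiber b g x) <= e * hnorm x).
Proof.
move=> cK e0.
pose V c : set G := interior [set g | cnorm (alpha (g^-1)%g b - alpha (c^-1)%g b) < e].
have [|l lP] := compact_finite_cover (V := V) cK.
  by move=> c _; apply: open_nbhs_nbhs; split; [exact: open_interior|exact: action_near].
have [l' [mP l'P]] := disjoint_step [seq (V c : set (borel G), c) | c <- l].
exists l'; split.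
  apply: (mP measurable); first by move=> *; exact: measurableD.
  by move=> p /mapP[c _ ->] /=; apply: borel_open; exact: open_interior.
move=> g x s.
case: (l'P R H (fun c => fiber b c x) g) => [[_ /mapP[c cl ->] [Vc sE]]|[nV sE]].
  rewrite /s sE; split => [|_ /=]; first exact: fiber_le.
  rewrite Defs.hnormB.
  have -> : fiber b g x - fiber b c x = pi (alpha (g^-1)%g b - alpha (c^-1)%g b) x.
    by rewrite (linearB_of (rep_linear pi_rep)).
  apply: le_trans (ccp_le alpha_action _ _ pi_ccp) _.
  by rewrite ler_wpM2r ?hnorm_ge0// ltW//; have := interior_subset Vc; exact.
rewrite /s sE; split => [|/lP[c cl Vc]]; first by rewrite hnorm0 mulr_ge0 ?hnorm_ge0 ?cnorm_ge0.
by case: (nV (V c, c) (map_f _ cl)).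
Qed.

(** Strong measurability is the issue: the fibres are replaced by step functions accurate to 1/(n+1)
    on [L n], and [xi] by its simple approximants. *)
Lemma pi_alpha_lift b xi :
  exists eta : L2fun mu H, {ae mu, forall g, eta g = fiber b g (xi g)}.
Proof.
have [L [cL LP]] := ae_exhausted_support G_hausdorff mu_haar xi.
have /choice[l lP] n := step_exists b (cL n) (harmonic_gt0 n).
pose U : set G := [set g | exists N, forall n, (N <= n)%N -> L n g].
(* Strong measurability asks for convergence at every point, but the compact sets exhaust the
   support of [xi] almost everywhere; [eta] is set to 0 on the rest. *)
pose eta g := if `[< U g >] then fiber b g (xi g) else 0.
have [[s [ss sxi]] _] := L2funP xi.
suff sq : square_integrable mu (eta : borel G -> H).
  have sqP : (eta : borel G -> H) \in @L2pred _ (borel G) R mu H by apply/L2predP.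
  exists (MkL2fun sqP); apply: filterS LP => g Lg /=; rewrite /eta.
  case: asboolP => // nU; have [->|x0] := pselect (xi g = 0).
    by rewrite (bounded_op0 (rep_bounded pi_rep _)).
  by case: nU; exact: Lg.
apply: (@square_integrable_le _ _ _ mu H (cnorm b) _ xi); last first.
  move=> g; rewrite /eta; case: ifP => _; first exact: fiber_le.
  by rewrite hnorm0 mulr_ge0 ?hnorm_ge0 ?cnorm_ge0.
have mU : measurable (U : set (borel G)).
  rewrite (_ : U = \bigcup_N \bigcap_(n in [set n | (N <= n)%N]) L n); last first.
    by apply/seteqP; split=> [g [N NP]|g [N _ NP]]; exists N.
  apply: bigcup_measurable => N _; apply: bigcap_measurable => [|n _]; first by exists N => /=.
  by apply: borel_compact.
exists (fun n g => (\1_U g : R[i]) *: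
  \sum_(p <- l n) (\1_(p.1) g : R[i]) *: fiber b p.2 (s n g)); split.
  move=> n; apply: (@simple_fct_elementary _ _ _ mu H U id) => //.
    by split => //; exists 1 => x; rewrite mul1r.
  have [lm _] := lP n.
  rewrite (_ : (fun g => _) = fun g => \sum_(p <- l n | p \in l n)
      (\1_(p.1) g : R[i]) *: fiber b p.2 (s n g)); last first.
    by apply/funext => g; rewrite -big_seq.
  apply: simple_fct_sum => p pl.
  apply: simple_fct_elementary => //; first exact: lm.
  exact: (rep_bounded pi_rep).
move=> g; rewrite /eta; case: asboolP => Ug; last first.
  under eq_fun do rewrite indicE memNset// scale0r subrr hnorm0.
  exact: cvg_cst.
have [N NP] := Ug.
have cv : (fun n => cnorm b * hnorm (s n g - xi g) + harmonic n * hnorm (xi g)) @ \oo --> (0 : R).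
  rewrite -[X in _ --> X](addr0 (0 : R)); apply: cvgD.
    by rewrite -[X in _ --> X](mulr0 (cnorm b)); apply: cvgMl_tmp.
  by rewrite -[X in _ --> X](mul0r (hnorm (xi g))); apply: cvgMr_tmp; exact: cvg_harmonic.
apply: (@squeeze_cvgr _ _ _ _ (cst 0) _ _ _ _ (cvg_cst _) cv).
exists N => // n /NP Lng /=; rewrite hnorm_ge0 /= indicE mem_set// scale1r.
have [_ /(_ g)lg] := lP n.
have [_ /(_ Lng) h2] := lg (xi g); have [h1 _] := lg (s n g - xi g).
(* Split the error: the step function applied to [s n g - xi g], then the step function against the
   true fibre at [xi g]. *)
rewrite -(subrK (\sum_(p <- l n) (\1_(p.1) g : R[i]) *: fiber b p.2 (xi g))
  (\sum_(p <- l n) _)) -addrA.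
apply: le_trans (ler_hnormD _ _) _; apply: lerD => //.
apply: le_trans h1; rewrite -sumrB le_eqVlt; apply/orP; left; apply/eqP.
congr hnorm; apply: eq_bigr => p _; rewrite -scalerBr; congr (_ *: _).
have bp := rep_bounded pi_rep (alpha (p.2^-1)%g b).
by rewrite bounded_opB//.
Qed.

End PiAlpha.

(** Real and imaginary parts are bounded separately; the factor 2 is not sharp but suffices for weak
    approximation. *)
Lemma norm_inner_le (R : realType) (V : preHilbertType R) (x y : V) :
  `|inner x y| <= ((2 * (hnorm x * hnorm y))%:C)%C.
Proof.
have hi : hnorm (('i : R[i])%C *: y) = hnorm y.
  apply: (@pexpIrn _ 2%N); rewrite ?nnegrE ?hnorm_ge0//.
  by rewrite hnormZ_sqr /= expr0n expr1n add0r mul1r.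
have a := ler_norm_Re_inner x y.
have b := ler_norm_Re_inner x (('i : R[i])%C *: y).
rewrite -Im_inner hi in b.
rewrite normc_def lecR.
have xy : 0 <= hnorm x * hnorm y by rewrite mulr_ge0 ?hnorm_ge0.
have sq (u : R) : `|u| <= hnorm x * hnorm y -> u ^+ 2 <= (hnorm x * hnorm y) ^+ 2.
  by move=> h; rewrite -real_normK ?num_real// ler_pXn2r ?nnegrE.
rewrite -(@ler_pXn2r _ 2%N) ?nnegrE ?sqrtr_ge0 ?mulr_ge0 ?hnorm_ge0// sqr_sqrtr ?addr_ge0 ?sqr_ge0//.
by have := sq _ a; have := sq _ b; have := sqr_ge0 (hnorm x * hnorm y); lra.
Qed.

Lemma Rintegral_sum d (T : measurableType d) (R : realType)
    (mu : {measure set T -> \bar R}) (I : Type) (r : seq I) (f : I -> T -> R) :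
  (forall i, mu.-integrable setT (EFin \o f i)) ->
  mu.-integrable setT (EFin \o (fun t => \sum_(i <- r) f i t)) /\
  \int[mu]_t (\sum_(i <- r) f i t) = \sum_(i <- r) \int[mu]_t f i t.
Proof.
move=> fi; elim: r => [|i r [IH1 IH2]].
  under [X in EFin \o X]eq_fun do rewrite big_nil.
  under eq_Rintegral do rewrite big_nil.
  rewrite big_nil; split; first exact: integrable0.
  by rewrite Rintegral_cst// mul0r.
under [X in EFin \o X]eq_fun do rewrite big_cons.
under eq_Rintegral do rewrite big_cons.
by rewrite big_cons RintegralD// IH2; split => //; have := integrableD measurableT (fi i) IH1; exact.
Qed.

(** * Complete contractivity and range of [pi_alpha] *)

Section PiAlphaProperties.
Variables (R : realType) (G : topologicalGroupType).
Variables (mu : {measure set (borel G) -> \bar R}).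
Hypotheses (G_hausdorff : hausdorff_space G) (mu_haar : left_haar_measure mu).
Variables (B : cstarAlgType R) (alpha : G -> B -> B).
Hypothesis alpha_action : cstar_action alpha.
Variables (H : hilbertType R) (pi : B -> H -> H).
Hypotheses (pi_rep : star_representation pi) (pi_ccp : ccp_map pi).
Implicit Types (b : B) (g : G) (xi : L2fun mu H).

Local Notation fiber b := (fun g => pi (alpha (g^-1)%g b)).

Lemma pi_alpha_exists : exists pa : B -> L2 mu H -> L2 mu H, is_pi_alpha alpha pi pa.
Proof.
have /choice[pa paP] b : exists S : L2 mu H -> L2 mu H, fiberwise_op (fiber b) S.
  by apply: fiberwise_exists => xi; exact: (pi_alpha_lift G_hausdorff mu_haar alpha_action pi_rep pi_ccp).
by exists pa.
Qed.

Variable pa : B -> L2 mu H -> L2 mu H.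
Hypothesis paP : is_pi_alpha alpha pi pa.

Lemma pi_alpha_rep : star_representation pa.
Proof.
have Lg g : forall (a : R[i]) x y, alpha g (a *: x + y) = a *: alpha g x + alpha g y.
  by move=> *; exact: (action_linear alpha_action).
split.
- move=> b; apply: (fiberwise_bounded (cnorm_ge0 b) (paP b)).
    by move=> g a x y; have [-> _] := rep_bounded pi_rep (alpha (g^-1)%g b).
  by move=> g x; exact: (fiber_le alpha_action pi_ccp).
- move=> a b c; apply: (fiberwise_unique (paP _)).
  apply: fiberwise_ext (fiberwise_linear a (paP b) (paP c)) => g x.
  by rewrite Lg (rep_linear pi_rep).
- move=> b c; apply: (fiberwise_unique (paP _)).
  apply: fiberwise_ext (fiberwise_comp (paP b) (paP c)) => g x.
  by rewrite (action_mul alpha_action) (rep_mul pi_rep).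
- move=> b; apply: (fiberwise_adjoint (paP b) (paP (star b))) => g x y.
  by rewrite (action_star alpha_action) (rep_star pi_rep).
Qed.

(** At each [g], complete contractivity of [pi] is used for the norm twisted by [g] and the matrix
    moved by [g^-1], which has norm [nu X]; the inequality is then integrated over [G]. *)
Lemma pi_alpha_cc : completely_contractive pa.
Proof.
move=> n nu nuP X v.
pose f j := repr (v j).
have vE j : v j = L2class (f j) by rewrite /L2class /f reprK.
have /choice[eta etaP] (i : 'I_n) : exists eta : 'I_n -> L2fun mu H, forall j : 'I_n,
    {ae mu, forall g, eta j g = fiber (X i j) g (f j g)} /\
    pa (X i j) (v j) = L2class (eta j).
  have /choice[eta etaP] j : exists eta : L2fun mu H,
      {ae mu, forall g, eta g = fiber (X i j) g (f j g)} /\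
      pa (X i j) (v j) = L2class eta by rewrite vE; exact: paP.
  by exists eta.
have ampE i : amplification pa X v i = L2class (\sum_j eta i j).
  by rewrite L2class_sum; apply: eq_bigr => j _; have [_ ->] := etaP i j.
under eq_bigr do rewrite ampE hnorm_L2class.
under [X in _ <= _ * X]eq_bigr do rewrite vE hnorm_L2class.
have int1 i := integrable_hnorm_sqr (\sum_j eta i j).
have int2 j := integrable_hnorm_sqr (f j).
have [i1 <-] := Rintegral_sum (index_enum 'I_n) int1.
have [i2 <-] := Rintegral_sum (index_enum 'I_n) int2.
rewrite -RintegralZl//; apply: ae_le_Rintegral => //.
  have := integrableZl measurableT (nu X ^+ 2) i2; exact.
have h : {ae mu, forall g, forall i j, eta i j g = fiber (X i j) g (f j g)}.
  apply: (filter_forall (F := almost_everywhere mu)) => i.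
  apply: (filter_forall (F := almost_everywhere mu)) => j.
  exact: (etaP i j).1.
apply: (filterS (F := almost_everywhere mu) _ h) => g {}h.
have := ccp_contractive pi_ccp (cstar_norm_mxact alpha_action g nuP)
  (mxact alpha (g^-1)%g X) (fun j => f j g).
rewrite /= (_ : mxact alpha g _ = X); last first.
  by apply/funext => i; apply/funext => j; exact: actionVK.
apply: le_trans; rewrite le_eqVlt; apply/orP; left; apply/eqP.
apply: eq_bigr => i _; rewrite L2val_sum /amplification; congr (hnorm _ ^+ 2).
by apply: eq_bigr => j _; rewrite h.
Qed.

Lemma pi_alpha_ccp : ccp_map pa.
Proof.
split.
- exact: (rep_bounded pi_alpha_rep).
- exact: (rep_linear pi_alpha_rep).
- exact: (star_representation_cp pi_alpha_rep).
- exact: pi_alpha_cc.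
Qed.

Lemma step_operator b (N : set (L2 mu H -> L2 mu H)) (l : seq (set (borel G) * G)) :
  von_neumann_algebra N -> elementary_tensors mu H `<=` N ->
  (forall p, p \in l -> measurable p.1) ->
  exists2 S, N S & fiberwise_op
    (fun g x => \sum_(p <- l) (\1_(p.1) g : R[i]) *: fiber b p.2 x) S.
Proof.
move=> vN eN; elim: l => [|p l IH] lm.
  exists 0; last first.
    by apply: fiberwise_ext (@fiberwise0 R G mu H) => g x; rewrite big_nil.
  (* The zero operator lies in [N] as the combination - id + id. *)
  have := vna_linear vN (-1) (vna_id vN) (vna_id vN); congr (N _).
  by apply/funext => x; rewrite scaleN1r; exact: addNr.
have [|S NS SP] := IH; first by move=> q ql; apply: lm; rewrite inE ql orbT.
have [S1 [eS1 S1P]] := elementary_exists mu (lm p (mem_head _ _))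
  (rep_bounded pi_rep (alpha (p.2^-1)%g b)).
exists (1 *: S1 + S); first by apply: vna_linear => //; exact: eN.
apply: fiberwise_ext (fiberwise_linear 1 S1P SP) => g x.
by rewrite big_cons scale1r.
Qed.

(** A weak neighbourhood involves finitely many vectors, whose supports share one compact
    exhaustion. Step operators built on it lie in every [N] and converge to [pa b] in norm on these
    vectors. *)
Lemma pi_alpha_tensor b : tensor_Linfty mu H (pa b).
Proof.
move=> N vN eN; apply: (vna_weakly_closed vN); first exact: (rep_bounded pi_alpha_rep).
move=> s e e0.
have [L [cL LP]] := ae_exhausted_supports G_hausdorff mu_haar [seq repr p.1 | p <- s].
have /choice[l lP] n := step_exists alpha_action pi_rep pi_ccp b (cL n) (harmonic_gt0 n).
have /choice[S SP] n : exists S, N S /\ fiberwise_op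
    (fun g x => \sum_(p <- l n) (\1_(p.1) g : R[i]) *: fiber b p.2 x) S.
  by have [S] := step_operator b vN eN (lP n).1; exists S.
have cv u : u \in [seq repr p.1 | p <- s] ->
    (fun n => hnorm (S n (L2class u) - pa b (L2class u))) @ \oo --> (0 : R).
  move=> us; have [eta [etaP ->]] := paP b u.
  have /choice[zeta zetaP] n := (SP n).2 u.
  under eq_fun do rewrite (zetaP _).2.
  have zetaE : {ae mu, forall g, forall n, zeta n g =
      \sum_(p <- l n) (\1_(p.1) g : R[i]) *: fiber b p.2 (u g)}.
    by apply/ae_foralln => n; have [] := zetaP n.
  (* The step operator and the fibre are each bounded by [cnorm b]. *)
  apply: (@L2_dominated_cvg _ _ _ mu H (2 * cnorm b) _ _ u).
  - by rewrite mulr_ge0 ?cnorm_ge0.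
  - apply: (filterS3 (F := almost_everywhere mu) _ _ zetaE etaP LP) => g zE eE Lg.
    have [u0|u0] := pselect (u g = 0).
      under eq_fun => n.
        rewrite zE eE u0 big1 ?(bounded_op0 (rep_bounded pi_rep _)) ?subr0 ?hnorm0; last first.
          by move=> p _; rewrite (bounded_op0 (rep_bounded pi_rep _)) scaler0.
        over.
      exact: cvg_cst.
    have [|M MP] := Lg; first by exists u.
    have cvh : (fun n => harmonic n * hnorm (u g)) @ \oo --> (0 : R).
      by rewrite -[X in _ --> X](mul0r (hnorm (u g))); apply: cvgMr_tmp; exact: cvg_harmonic.
    apply: (@squeeze_cvgr _ _ _ _ (cst 0) _ _ _ _ (cvg_cst _) cvh).
    exists M => // n /MP Lng /=; rewrite hnorm_ge0 /= zE eE.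
    by have [_ /(_ g (u g))[_]] := lP n; exact.
  - apply: (filterS2 (F := almost_everywhere mu) _ _ zetaE etaP) => g zE eE n; rewrite zE eE.
    have [_ /(_ g (u g))[h _]] := lP n.
    apply: le_trans (ler_hnormD _ _) _; rewrite Defs.hnormN.
    have := fiber_le alpha_action pi_ccp b g (u g); move: h => /=; lra.
(* The 2 comes from [norm_inner_le], the sum dominates every |p.2|, and the 1 ensures positivity. *)
pose C := 2 * (1 + \sum_(p <- s) hnorm p.2).
have C0 : 0 < C by rewrite mulr_gt0// ltr_pwDl// sumr_ge0// => p _; exact: hnorm_ge0.
have [n nP] : exists n, forall p, p \in s -> hnorm (S n p.1 - pa b p.1) < e / C.
  suff : \forall n \near \oo, forall p, p \in s -> hnorm (S n p.1 - pa b p.1) < e / C.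
    by move=> [n _ /(_ n (leqnn n))]; exists n.
  have : forall p, p \in s ->
      (fun n => hnorm (S n p.1 - pa b p.1)) @ \oo --> (0 : R).
    move=> p ps; have := cv (repr p.1); rewrite /L2class reprK; apply.
    by apply/mapP; exists p.
  elim: (s) => [|p t IH] tcv; first exact: nearW.
  have /IH : forall q, q \in t -> (fun n => hnorm (S n q.1 - pa b q.1)) @ \oo --> (0 : R).
    by move=> q qt; apply: tcv; rewrite inE qt orbT.
  have /cvgrPdist_lt/(_ _ (divr_gt0 e0 C0)) := tcv p (mem_head _ _).
  apply: filterS2 => n; rewrite sub0r normrN ger0_norm ?hnorm_ge0// => h k q.
  by rewrite inE => /orP[/eqP ->|/k].
exists (S n); first exact: (SP n).1.
move=> p ps; apply: le_lt_trans (norm_inner_le _ _) _; rewrite ltcR.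
rewrite Defs.hnormB; have := nP p ps; rewrite ltr_pdivlMr// => h.
have : hnorm p.2 <= \sum_(p <- s) hnorm p.2.
  by rewrite (big_rem p ps)/= lerDl sumr_ge0// => q _; exact: hnorm_ge0.
move=> h2; apply: le_lt_trans h; rewrite mulrCA ler_wpM2l ?hnorm_ge0// /C; lra.
Qed.

End PiAlphaProperties.

(** * Real limits along filters *)

Section FilterLimits.
Variables (R : realType) (I : Type) (U : set_system I).

(** A closed segment is compact, and a cluster point of an ultrafilter is a limit of it. *)
Lemma ultra_bounded_cvg {UU : UltraFilter U} (f : I -> R) (M : R) :
  (forall i, `|f i| <= M) -> exists l : R, f @ U --> l.
Proof.
move=> fM.
have [|l [_ lc]] := @segment_compact R (- M) M (f @ U) _.
  by apply: nearW => i /=; rewrite in_itv /= -ler_norml.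
exists l => V Vl; have [//|nV] := in_ultra_setVsetC (f @^-1` V) UU.
by have [z []] := lc (~` V) V nV Vl.
Qed.

Lemma cvg_sum_seq {UF : Filter U} (J : Type) (r : seq J) (f : J -> I -> R) (l : J -> R) :
  (forall j, f j @ U --> l j) ->
  (fun i => \sum_(j <- r) f j i) @ U --> \sum_(j <- r) l j.
Proof.
move=> fl; elim: r => [|j r IH].
  by rewrite big_nil; under eq_fun do rewrite big_nil; exact: cvg_cst.
by rewrite big_cons; under eq_fun do rewrite big_cons; exact: cvgD.
Qed.

Lemma cvg_ge_const {UP : ProperFilter U} (f : I -> R) (a l : R) :
  (forall i, a <= f i) -> f @ U --> l -> a <= l.
Proof.
move=> fa fl; rewrite leNgt; apply/negP => la.
have e0 : 0 < a - l by rewrite subr_gt0.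
move/cvgrPdist_lt/(_ _ e0) : fl => fl; have [i fi] := @filter_ex _ U UP _ fl.
move: fi; rewrite ltr_norml => /andP[h _]; have := fa i; move: h; lra.
Qed.

Lemma cvg_le_const {UP : ProperFilter U} (f : I -> R) (a l : R) :
  (forall i, f i <= a) -> f @ U --> l -> l <= a.
Proof.
move=> fa fl; rewrite -lerN2; apply: (@cvg_ge_const _ (fun i => - f i)).
  by move=> i; rewrite lerN2.
exact: cvgN.
Qed.

Lemma cvg_uniqueR {UP : ProperFilter U} (f : I -> R) (l l' : R) :
  f @ U --> l -> f @ U --> l' -> l = l'.
Proof. by move=> h h'; apply: (cvg_unique (@Rhausdorff R) h h'). Qed.

End FilterLimits.

(** * Weak limits of compressions *)

Section Compression.
Variables (R : realType) (B : cstarAlgType R).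

(** Moves a complex scalar onto the test vector, so that complex linearity of a weak limit can be
    checked on real parts. *)
Lemma Re_innerZ (V : preHilbertType R) (a : R[i]) (x y : V) :
  complex.Re (inner (a *: x) y) = complex.Re (inner x ((a^*)%C *: y)).
Proof. by rewrite innerZl innerZr conjcK. Qed.

Variables (V : preHilbertType R) (H : hilbertType R) (psi : B -> V -> V).
Hypothesis psi_ccp : ccp_map psi.
Variables (I : Type) (U : set_system I) (UU : UltraFilter U) (W : I -> H -> V).
Hypothesis W_linear : forall i (a : R[i]) x y, W i (a *: x + y) = a *: W i x + W i y.
Hypothesis W_isometry : forall i x, hnorm (W i x) = hnorm x.

(* The weak limit along an ultrafilter of the compressions of [psi] by isometries. *)
Lemma compression_limit : exists phi : B -> H -> H, ccp_map phi /\
  forall b x y, (fun i => complex.Re (inner (psi b (W i x)) (W i y))) @ U -->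
    complex.Re (inner (phi b x) y).
Proof.
have WD i x y : W i (x + y) = W i x + W i y by have := W_linear i 1 x y; rewrite !scale1r.
have W0 i : W i 0 = 0 by apply: (addrI (W i 0)); rewrite -WD !addr0.
have WZ i a x : W i (a *: x) = a *: W i x.
  by have := W_linear i a x 0; rewrite W0 !addr0.
have bp := ccp_bounded psi_ccp; have Lp := ccp_linear psi_ccp.
pose q b x y i := complex.Re (inner (psi b (W i x)) (W i y)).
have /choice[C CP] b : exists C : R, 0 < C /\ forall x, hnorm (psi b x) <= C * hnorm x.
  by have [C C0 h] := bounded_op_le (bp b); exists C.
have qC b x y i : `|q b x y i| <= C b * hnorm x * hnorm y.
  apply: le_trans (ler_norm_Re_inner _ _) _.
  have [_ h] := CP b; have := h (W i x); rewrite !W_isometry => hx.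
  by rewrite ler_wpM2r ?hnorm_ge0.
have /choice[l lP] (z : B * H * H) : exists l : R, q z.1.1 z.1.2 z.2 @ U --> l.
  exact: (ultra_bounded_cvg (qC _ _ _)).
have lE b x y (m : R) : q b x y @ U --> m -> l (b, x, y) = m.
  exact: cvg_uniqueR (lP (b, x, y)).
(* For fixed [b] and [x] the limit is real-linear in [y] and bounded by [C b * hnorm x], so a vector
   represents it. *)
have /choice[phi phiP] (z : B * H) : exists u : H, forall y, complex.Re (inner u y) = l (z.1, z.2, y).
  case: z => b x /=; apply: (@riesz_representation R H (fun y => l (b, x, y)) (C b * hnorm x)).
  - move=> y y'; apply: lE; rewrite (_ : q _ _ _ = fun i => q b x y i + q b x y' i).
      by apply: cvgD; [exact: (lP (b, x, y))|exact: (lP (b, x, y'))].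
    by apply/funext => i; rewrite /q WD innerDr ReD.
  - move=> t y; apply: lE; rewrite (_ : q _ _ _ = fun i => t * q b x y i).
      by apply: cvgMl_tmp; exact: (lP (b, x, y)).
    by apply/funext => i; rewrite /q WZ Re_innerC Re_innerZ_real Re_innerC.
  - move=> y; apply: (cvg_le_const _ (lP (b, x, y))) => i.
    by apply: le_trans (ler_norm _) _; exact: qC.
have phi_cvg b x y : q b x y @ U --> complex.Re (inner (phi (b, x)) y).
  by rewrite phiP; exact: (lP (b, x, y)).
exists (fun b x => phi (b, x)); split; last exact: phi_cvg.
(* Here [w] is independent of [v]: taking [w] to be [v], ['i] times [v], or the amplified vector
   gives positivity, vanishing imaginary part and contractivity respectively. *)
have amp_cvg n (X : mxalg n B) (v w : 'I_n -> H) :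
  (fun i => complex.Re (\sum_k inner (amplification psi X (W i \o v) k) (W i (w k)))) @ U -->
  complex.Re (\sum_k inner (amplification (fun b x => phi (b, x)) X v k) (w k)).
  under eq_fun do rewrite Re_sum; rewrite Re_sum; apply: cvg_sum_seq => k.
  under eq_fun do rewrite inner_suml Re_sum; rewrite inner_suml Re_sum.
  by apply: cvg_sum_seq => j; exact: phi_cvg.
split.
- move=> b; split.
    move=> a x x'; apply: Re_inner_inj => y.
    apply: (cvg_uniqueR (phi_cvg b (a *: x + x') y)).
    rewrite innerDl ReD Re_innerZ.
    rewrite (_ : q _ _ _ = fun i => q b x ((a^*)%C *: y) i + q b x' y i); first exact: cvgD.
    by apply/funext => i; rewrite /q W_linear (bp b).1 innerDl ReD Re_innerZ WZ.
  exists (C b) => x; have [->|x0] := eqVneq (hnorm (phi (b, x))) 0.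
    by rewrite mulr_ge0 ?hnorm_ge0 ?ltW//; have [] := CP b.
  have x1 : 0 < hnorm (phi (b, x)) by rewrite lt_def x0 hnorm_ge0.
  rewrite -(ler_pM2r x1) -expr2 hnorm_sqr.
  apply: (cvg_le_const _ (phi_cvg b x (phi (b, x)))) => i.
  by apply: le_trans (ler_norm _) _; exact: qC.
- move=> a b c; apply/funext => x; apply: Re_inner_inj => y.
  apply: (cvg_uniqueR (phi_cvg (a *: b + c) x y)).
  rewrite innerDl ReD Re_innerZ.
  rewrite (_ : q _ _ _ = fun i => q b x ((a^*)%C *: y) i + q c x y i); first exact: cvgD.
  by apply/funext => i; rewrite /q Lp innerDl ReD Re_innerZ WZ.
- move=> n Y v; rewrite lecE; apply/andP; split.
    set z := \sum_k _.
    have -> : complex.Im z = complex.Re (\sum_k inner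
        (amplification (fun b x => phi (b, x)) (smul (star Y) Y) v k)
        (('i : R[i])%C *: v k)).
      by rewrite /z Re_sum Im_sum; apply: eq_bigr => k _; rewrite Im_inner.
    apply/eqP; apply: (cvg_uniqueR (amp_cvg n (smul (star Y) Y) v (fun k => ('i : R[i])%C *: v k))).
    under eq_fun => i.
      rewrite (_ : complex.Re _ = 0); last first.
        have := ccp_positive psi_ccp Y (W i \o v); rewrite lecE => /andP[/eqP /= h _].
        by rewrite -[RHS]h Re_sum Im_sum; apply: eq_bigr => k _; rewrite Im_inner -WZ.
      over.
    exact: cvg_cst.
  apply: (cvg_ge_const _ (amp_cvg n (smul (star Y) Y) v v)) => i.
  by have := ccp_positive psi_ccp Y (W i \o v); rewrite lecE => /andP[].
- move=> n nu nuP X v; set z := amplification _ X v.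
  (* Norms are not weakly continuous, so the squared norm of [z] is a pairing of [z] with itself,
     bounded by half of each squared norm; the half belonging to [z] is absorbed on the left. *)
  suff : \sum_i hnorm (z i) ^+ 2 <=
      2^-1 * (nu X ^+ 2 * (\sum_i hnorm (v i) ^+ 2) + \sum_i hnorm (z i) ^+ 2) by lra.
  have zE : \sum_i hnorm (z i) ^+ 2 = complex.Re (\sum_i inner (z i) (z i)).
    by rewrite Re_sum; apply: eq_bigr => i _; rewrite hnorm_sqr.
  rewrite [leLHS]zE; apply: (cvg_le_const _ (amp_cvg n X v z)) => i.
  have := ccp_contractive psi_ccp nuP X (W i \o v).
  under [X in _ * X]eq_bigr do rewrite /= W_isometry.
  move=> h; rewrite Re_sum.
  apply: (@le_trans _ _ (2^-1 * (\sum_k hnorm (amplification psi X (W i \o v) k) ^+ 2 +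
      \sum_k hnorm (z k) ^+ 2))).
    rewrite -big_split mulr_sumr; apply: ler_sum => k _ /=.
    by rewrite -[in leRHS](W_isometry i); exact: Re_inner_le_sqr.
  by move: h; lra.
Qed.

End Compression.

(** * Commutants *)

(** With [S] a multiplication by an indicator this is a von Neumann algebra containing the
    elementary tensors, hence everything they generate. Self-adjointness of [S] gives stability
    under adjoints and lets [S] change sides in weak limits. *)
Lemma commutant_von_neumann (R : realType) (V : preHilbertType R) (S : V -> V) :
  bounded_op S -> adjoint_op S S ->
  von_neumann_algebra [set T : V -> V | bounded_op T /\ T \o S = S \o T].
Proof.
move=> bS aS; split.
- by move=> T [].
- split=> //; split => //; by exists 1 => x; rewrite mul1r.
- move=> a T1 T2 [b1 c1] [b2 c2]; split; last first.
    apply/funext => x; have /= := congr1 (@^~ x) c1; have /= := congr1 (@^~ x) c2.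
    by move=> e2 e1; rewrite [LHS](_ : _ = a *: T1 (S x) + T2 (S x))// e1 e2 -(bS.1).
  have [M1 M10 h1] := bounded_op_le b1; have [M2 M20 h2] := bounded_op_le b2.
  split.
    move=> c x y; rewrite [LHS](_ : _ = a *: T1 (c *: x + y) + T2 (c *: x + y))//.
    rewrite b1.1 b2.1 [RHS](_ : _ = c *: (a *: T1 x + T2 x) + (a *: T1 y + T2 y))//.
    by rewrite !scalerDr !scalerA mulrC addrACA.
  exists (Num.sqrt (complex.Re a ^+ 2 + complex.Im a ^+ 2) * M1 + M2) => x.
  rewrite [X in hnorm X](_ : _ = a *: T1 x + T2 x)//.
  apply: le_trans (ler_hnormD _ _) _; rewrite mulrDl; apply: lerD; last exact: h2.
  rewrite hnorm_scale -mulrA ler_wpM2l ?sqrtr_ge0//; exact: h1.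
- move=> T1 T2 [b1 c1] [b2 c2]; split.
    split; first by move=> a x y; rewrite /= b2.1 b1.1.
    have [M1 M10 h1] := bounded_op_le b1; have [M2 M20 h2] := bounded_op_le b2.
    exists (M1 * M2) => x; apply: le_trans (h1 _) _.
    by rewrite -mulrA ler_wpM2l// ltW.
  by rewrite -compA c2 compA c1 -compA.
- move=> T1 T2 [b1 c1] b2 a12; split => //; apply/funext => y; apply: Re_inner_inj => x.
  have c x' : T1 (S x') = S (T1 x') by have := congr1 (@^~ x') c1.
  by rewrite Re_innerC -a12 aS [RHS]Re_innerC/= -aS -c a12 aS.
- move=> T bT h; split => //; apply/funext => x; apply: Re_inner_inj => y.
  apply/eqP; rewrite -subr_eq0 -normr_le0; apply/ler_addgt0Pr => e e0; rewrite add0r.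
  have e2 : 0 < e / 2 by rewrite divr_gt0.
  (* These two pairs control <T S x, y> and <T x, S y> = <S T x, y>, each to within e/2. *)
  have [T1 [b1 c1] hT] := h [:: (S x, y); (x, S y)] _ e2.
  have c x' : T1 (S x') = S (T1 x') by have := congr1 (@^~ x') c1.
  have hR (z : R[i]) : `|z| < ((e / 2)%:C)%C -> `|complex.Re z| < e / 2.
    by move=> hz; rewrite -ltcR; apply: le_lt_trans hz; exact: normc_ge_Re.
  have := hR _ (hT (S x, y) (mem_head _ _)).
  have : (x, S y) \in [:: (S x, y); (x, S y)] by rewrite !inE eqxx orbT.
  move=> /hT /hR /=; rewrite !innerDl !innerNl !ReB c !aS => k1 k2.
  set p := complex.Re (inner (T (S x)) y) in k2 *.
  set r := complex.Re (inner (T x) (S y)) in k1 *.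
  move: k1 k2; set u := complex.Re _ => k1 k2.
  rewrite (_ : p - r = (p - u) - (r - u)); last by ring.
  by apply: le_trans (ler_normB _ _) _; lra.
Qed.

(** * Local behaviour of [pi_alpha] and of its extensions *)

Section Uniqueness.
Variables (R : realType) (G : topologicalGroupType).
Variables (mu : {measure set (borel G) -> \bar R}).
Variables (B : cstarAlgType R) (alpha : G -> B -> B).
Hypothesis alpha_action : cstar_action alpha.
Variables (H : hilbertType R) (pi : B -> H -> H).
Hypotheses (pi_rep : star_representation pi) (pi_ccp : ccp_map pi).
Variable pa : B -> L2 mu H -> L2 mu H.
Hypothesis paP : is_pi_alpha alpha pi pa.
Implicit Types (b : B) (g : G) (E F : set (borel G)) (x y : H).

Local Notation fiber b := (fun g => pi (alpha (g^-1)%g b)).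
Local Notation ind E x := (indicator mu E x).

Definition finite_measure_set E := measurable E /\ (mu E < +oo)%E.

Lemma ind_linear E (a : R[i]) x y : finite_measure_set E ->
  ind E (a *: x + y) = a *: ind E x + ind E y.
Proof.
move=> [mE fE]; rewrite !indicatorE -L2class_linear; apply/L2class_eq; apply: nearW => g.
by rewrite L2valP !indicL2E// scalerDr !scalerA mulrC.
Qed.

Lemma Re_inner_ind E x y : finite_measure_set E ->
  complex.Re (inner (ind E x) (ind E y)) = fine (mu E) * complex.Re (inner x y).
Proof.
move=> [mE fE]; rewrite !indicatorE Re_inner_L2class.
have -> : \int[mu]_t complex.Re (inner (indicL2 mu E x t) (indicL2 mu E y t)) =
    \int[mu]_t (complex.Re (inner x y) * \1_E t).
  apply: eq_Rintegral => t _; rewrite !indicL2E// !indicE.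
  by case: (t \in E); rewrite ?scale1r ?mulr1// !scale0r inner0l Re0 mulr0.
have iE : mu.-integrable setT (EFin \o (\1_E : borel G -> R)).
  apply/integrableP; split; first by apply/measurable_EFinP; exact: measurable_indic.
  under eq_integral do rewrite /= ger0_norm//.
  by rewrite integral_indic// setIT.
by rewrite RintegralZl// mulrC; congr (_ * _); rewrite /Rintegral integral_indic// setIT.
Qed.

Lemma hnorm_ind E x : finite_measure_set E ->
  hnorm (ind E x) ^+ 2 = fine (mu E) * hnorm x ^+ 2.
Proof. by move=> fE; rewrite hnorm_sqr Re_inner_ind// -hnorm_sqr. Qed.

Lemma hnorm_ind_mul E x y : finite_measure_set E ->
  hnorm (ind E x) * hnorm (ind E y) = fine (mu E) * (hnorm x * hnorm y).
Proof.
move=> fE; have m0 : 0 <= fine (mu E) by exact: fine_ge0.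
apply: (@pexpIrn _ 2%N); rewrite ?nnegrE ?mulr_ge0 ?hnorm_ge0//.
move: (hnorm_ind x fE) (hnorm_ind y fE).
move: (hnorm (ind E x)) (hnorm (ind E y)) (hnorm x) (hnorm y) => u v s t hu hv.
by rewrite /= exprMn hu hv; ring.
Qed.

(** For [E] close to [g0], the fibres over [E] differ from the fibre at [g0] by at most e/C in norm.
    Cauchy-Schwarz contributes mu(E) |x| |y|, and [C] exceeds |x| |y|. *)
Lemma pi_alpha_local b g0 x y (e : R) : 0 < e ->
  exists2 V : set G, nbhs g0 V & forall E, finite_measure_set E -> E `<=` V ->
    `|complex.Re (inner (pa b (ind E x)) (ind E y)) -
      fine (mu E) * complex.Re (inner (fiber b g0 x) y)| <= e * fine (mu E).
Proof.
move=> e0; pose C := 1 + hnorm x * hnorm y.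
have C0 : 0 < C by rewrite ltr_pwDl// mulr_ge0 ?hnorm_ge0.
have eC : 0 < e / C by rewrite divr_gt0.
exists [set g | cnorm (alpha (g^-1)%g b - alpha (g0^-1)%g b) < e / C].
  exact: action_near.
move=> E fE EV; have [mE muE] := fE.
have m0 : 0 <= fine (mu E) by exact: fine_ge0.
rewrite -Re_inner_ind//.
rewrite [ind E x]indicatorE.
have [eta [etaP ->]] := paP b (indicL2 mu E x); rewrite [ind E (pi _ _)]indicatorE.
rewrite -ReB -innerNl -innerDl -L2classB.
apply: le_trans (ler_norm_Re_inner _ _) _.
apply: (@le_trans _ _ (e / C * (hnorm (ind E x) * hnorm (ind E y)))).
  rewrite mulrA ler_wpM2r ?hnorm_ge0// [ind E x]indicatorE; apply: L2_le; first exact: ltW.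
  apply: filterS etaP => g etaE; rewrite L2valB etaE !indicL2E// indicE.
  case: (boolP (g \in E)) => [|_] /=; last first.
    by rewrite !scale0r subr0 (bounded_op0 (rep_bounded pi_rep _)) hnorm0 mulr0.
  rewrite inE => /EV Vg; rewrite !scale1r.
  have -> : pi (alpha (g^-1)%g b) x - pi (alpha (g0^-1)%g b) x =
      pi (alpha (g^-1)%g b - alpha (g0^-1)%g b) x.
    by rewrite (linearB_of (rep_linear pi_rep)).
  apply: le_trans (ccp_le alpha_action _ _ pi_ccp) _.
  by rewrite ler_wpM2r ?hnorm_ge0// ltW.
rewrite hnorm_ind_mul// mulrCA mulrC ler_wpM2r// mulrAC ler_pdivrMr//.
by rewrite ler_wpM2l ?(ltW e0)// /C lerDr.
Qed.

Variable A : set B.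
Hypothesis A_invariant : forall g (a : B), A a -> A (alpha g a).
Hypothesis pi_uep : unique_extension_property A pi.
Variable psi : B -> L2 mu H -> L2 mu H.
Hypotheses (psi_ccp : ccp_map psi) (psi_pa : forall a, A a -> psi a = pa a).

(** For contractivity, the norm twisted by [g^-1] takes the value [nu X] at the matrix moved by
    [g]. *)
Lemma ccp_map_action (V : preHilbertType R) (phi : B -> V -> V) g :
  ccp_map phi -> ccp_map (fun b => phi (alpha g b)).
Proof.
move=> [b l p c]; split.
- by move=> a; exact: b.
- by move=> a x y; rewrite (action_linear alpha_action) l.
- move=> n Y v; have := p n (mxact alpha g Y) v.
  by rewrite -(mxact_star alpha_action) -(mxact_mul alpha_action).
- move=> n nu nuP X v.
  have := c n _ (cstar_norm_mxact alpha_action (g^-1)%g nuP) (mxact alpha g X) v.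
  rewrite /= (_ : mxact alpha (g^-1)%g _ = X)//.
  by apply/funext => i; apply/funext => j; exact: (actionK alpha_action).
Qed.

(** By contradiction: if every neighbourhood of [g0] contains a set violating the estimate, these
    bad sets form a proper filter shrinking to [g0]. Along an ultrafilter refining it the
    compressions converge to [pi], which contradicts badness. *)
Lemma extension_local b g0 x y (e : R) : 0 < e ->
  exists2 V : set G, nbhs g0 V & forall E, finite_measure_set E -> E `<=` V ->
    `|complex.Re (inner (psi b (ind E x)) (ind E y)) -
      fine (mu E) * complex.Re (inner (fiber b g0 x) y)| <= e * fine (mu E).
Proof.
move=> e0; apply: contrapT => /forall2NP nV.
pose good := {E : set (borel G) | finite_measure_set E /\ (0 < mu E)%E}.
pose m (E : good) := fine (mu (sval E)).
have m_gt0 i : 0 < m i.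
  by case: i => E [[mE fE] E0]; rewrite /m /= fine_gt0// E0.
pose bad (E : good) := e * m E < `|complex.Re (inner (psi b (ind (sval E) x)) (ind (sval E) y)) -
      m E * complex.Re (inner (fiber b g0 x) y)|.
pose F : set_system good := filter_from (nbhs g0) (fun V => [set i : good | sval i `<=` V /\ bad i]).
have PF : ProperFilter F.
  apply: filter_from_proper; last first.
    move=> V gV; have [//|] := nV V.
    move=> /existsNP[E /not_implyP[fE /not_implyP[EV /negP]]]; rewrite -ltNge => badE.
    (* On a null set both sides of the estimate are 0, so a bad set has positive measure and can be
       normalised. *)
    have E0 : (0 < mu E)%E.
      rewrite lt0e measure_ge0 andbT; apply/eqP => E0.
      have mE0 : fine (mu E) = 0 by rewrite E0.
      move: badE; rewrite mE0 mul0r mulr0 subr0 ltNge => /negP; apply.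
      apply: le_trans (ler_norm_Re_inner _ _) _.
      have z (u : H) : hnorm (ind E u) = 0.
        by apply/eqP; rewrite -sqrf_eq0 hnorm_ind// mE0 mul0r.
      by rewrite z mulr0.
    by exists (exist _ E (conj fE E0)).
  apply: filter_from_filter; first by exists setT; exact: filterT.
  move=> V1 V2 h1 h2; exists (V1 `&` V2); first exact: filterI.
  by move=> E [EV bE]; split; split => // g /EV[].
have [U [UU FU]] := ultraFilterLemma PF.
pose W (E : good) (z : H) := ((Num.sqrt (m E))^-1%:C)%C *: ind (sval E) z.
have fin (E : good) : finite_measure_set (sval E) by case: E => E [].
have W_linear i (a : R[i]) u v : W i (a *: u + v) = a *: W i u + W i v.
  by rewrite /W ind_linear// scalerDr !scalerA mulrC.
have sm i : 0 < Num.sqrt (m i) by rewrite sqrtr_gt0.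
have sm2 i : Num.sqrt (m i) ^+ 2 = m i by rewrite sqr_sqrtr// ltW.
have W_isometry i u : hnorm (W i u) = hnorm u.
  apply: (@pexpIrn _ 2%N); rewrite ?nnegrE ?hnorm_ge0//.
  rewrite hnormZ_real ?invr_ge0 ?sqrtr_ge0// exprMn hnorm_ind// exprVn sm2.
  by rewrite mulrA mulVf ?mul1r// gt_eqF.
have WE (T : L2 mu H -> L2 mu H) i u v : bounded_op T ->
    complex.Re (inner (T (W i u)) (W i v)) =
    (m i)^-1 * complex.Re (inner (T (ind (sval i) u)) (ind (sval i) v)).
  move=> bT; rewrite /W bounded_opZ// Re_innerZ_real Re_innerC Re_innerZ_real Re_innerC.
  by rewrite mulrA -invfM -expr2 sm2.
have [phi [phi_ccp phiP]] :=
  compression_limit (ccp_map_action g0 psi_ccp) UU W_linear W_isometry.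
have phiE : pi = phi.
  apply: pi_uep.2; split => // a Aa; apply/funext => u; apply: Re_inner_inj => v.
  apply: (cvg_uniqueR (phiP a u v)).
  (* Invariance puts [alpha g0 a] in [A], so [psi] may be replaced by [pa], whose fibre at [g0] is
     then [pi a]. *)
  rewrite psi_pa; last exact: A_invariant.
  apply/cvgrPdist_le => d d0.
  have [V gV VP] := pi_alpha_local (alpha g0 a) g0 u v d0.
  apply: (filterS (P := [set i : good | sval i `<=` V /\ bad i])); last by apply: FU; exists V.
  move=> E [EV _]; rewrite WE; last exact: (rep_bounded (pi_alpha_rep alpha_action pi_rep pi_ccp paP)).
  have := VP (sval E) (fin E) EV; rewrite (actionK alpha_action) -/(m E) => h.
  rewrite distrC -(ler_pM2r (m_gt0 E)) -[X in _ * X <= _]gtr0_norm// -normrM mulrBl.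
  by rewrite mulrAC mulVf ?gt_eqF// mul1r [X in _ - X]mulrC.
(* Evaluating at [alpha g0^-1 b] undoes the translation and returns to [psi b]. *)
have := phiP (alpha (g0^-1)%g b) x y; rewrite -phiE (actionVK alpha_action).
move/cvgrPdist_le/(_ _ e0) => Ue.
have Ub : U [set i : good | sval i `<=` setT /\ bad i] by apply: FU; exists setT => //; exact: filterT.
have [E [h0 [_ bE]]] := filter_ex (filterI Ue Ub).
have h : `|complex.Re (inner (fiber b g0 x) y) -
    complex.Re (inner (psi b (W E x)) (W E y))| <= e by exact: h0.
move: bE; rewrite /bad ltNge => /negP; apply; move: h.
rewrite (WE _ E x y (ccp_bounded psi_ccp b)) => h.
rewrite distrC -ler_pdivrMr// -[X in _ / X]gtr0_norm// -normfV -normrM mulrBl.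
by rewrite [X in X - _]mulrAC divff ?gt_eqF// mul1r [X in _ - X]mulrC.
Qed.

(** Multiplication by 1_E is self-adjoint and commutes with every T (x) f, so its commutant is one
    of the algebras intersected in [generated_vna]. *)
Lemma tensor_commutes (T : L2 mu H -> L2 mu H) E S : measurable E ->
  fiberwise_op (fun g x => (\1_E g : R[i]) *: x) S ->
  tensor_Linfty mu H T -> T \o S = S \o T.
Proof.
move=> mE SP HT.
have bS : bounded_op S.
  apply: (fiberwise_bounded ler01 SP).
    by move=> g a x y; rewrite scalerDr !scalerA mulrC.
  move=> g x; rewrite mul1r indicE; case: (g \in E); rewrite ?scale1r//.
  by rewrite scale0r hnorm0 hnorm_ge0.
have aS : adjoint_op S S.
  apply: (fiberwise_adjoint SP SP) => g x y; rewrite innerZl innerZr; congr (_ * _).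
  by rewrite indicE; case: (g \in E); rewrite ?conjc1 ?conjc0.
suff [] : [set T | bounded_op T /\ T \o S = S \o T] T by [].
apply: HT; first exact: commutant_von_neumann.
move=> T' [D [f [bD [[M fM] _] T'P]]]; split.
  have M0 : 0 <= M.
    by rewrite -lecR; exact: le_trans (normr_ge0 (f 1%g)) (fM 1%g).
  have [C C0 DC] := bounded_op_le bD.
  apply: (fiberwise_bounded (mulr_ge0 M0 (ltW C0)) T'P).
    by move=> g a x y; rewrite bD.1 scalerDr !scalerA mulrC.
  move=> g x; rewrite hnorm_scale -mulrA; apply: ler_pM; rewrite ?sqrtr_ge0 ?hnorm_ge0//.
  by have := fM g; rewrite normc_def lecR.
apply: (fiberwise_unique (fiberwise_comp T'P SP)).
apply: fiberwise_ext (fiberwise_comp SP T'P) => g x.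
by rewrite /= (bounded_opZ _ _ bD) !scalerA mulrC.
Qed.

End Uniqueness.

(** * Operators commuting with indicators *)

Section DiagonalOperators.
Variables (R : realType) (G : topologicalGroupType).
Variables (mu : {measure set (borel G) -> \bar R}).
Hypotheses (G_hausdorff : hausdorff_space G) (mu_haar : left_haar_measure mu).
Variable (H : hilbertType R).
Implicit Types (E F : set (borel G)) (x y : H).
Local Notation ind E x := (indicator mu E x).

Variable D : L2 mu H -> L2 mu H.
Hypothesis bD : bounded_op D.
Hypothesis D_commutes : forall E S, measurable E ->
  fiberwise_op (fun g x => (\1_E g : R[i]) *: x) S -> D \o S = S \o D.
Hypothesis D_local : forall (g0 : G) x y (e : R), 0 < e ->
  exists2 V : set G, nbhs g0 V & forall E, finite_measure_set mu E -> E `<=` V ->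
    `|complex.Re (inner (D (ind E x)) (ind E y))| <= e * fine (mu E).

Lemma finite_measure_setI E F : finite_measure_set mu E -> measurable F ->
  finite_measure_set mu (E `&` F).
Proof.
move=> [mE fE] mF; split; first exact: measurableI.
by apply: le_lt_trans fE; apply: le_measure; rewrite ?inE//; exact: measurableI.
Qed.

(** Multiplications by 1_E and 1_F are self-adjoint and commute with [D], so each can be carried to
    the other argument. *)
Lemma diagonal_inner E F x y : finite_measure_set mu E -> finite_measure_set mu F ->
  complex.Re (inner (D (ind E x)) (ind F y)) =
  complex.Re (inner (D (ind (E `&` F) x)) (ind (E `&` F) y)).
Proof.
move=> fE fF; have [mE _] := fE; have [mF _] := fF.
have b1 : bounded_op (id : H -> H) by split => //; exists 1 => z; rewrite mul1r.
have [SE [_ SEP]] := elementary_exists mu mE b1.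
have [SF [_ SFP]] := elementary_exists mu mF b1.
have aS E' S : fiberwise_op (fun g x => (\1_E' g : R[i]) *: x) S -> @adjoint_op R (L2 mu H) S S.
  move=> SP; apply: (fiberwise_adjoint SP SP) => g u v; rewrite innerZl innerZr; congr (_ * _).
  by rewrite indicE; case: (g \in E'); rewrite ?conjc1 ?conjc0.
have Sind E' F' S z : fiberwise_op (fun g x => (\1_E' g : R[i]) *: x) S ->
    measurable E' -> finite_measure_set mu F' ->
    S (ind F' z) = ind (F' `&` E') z.
  move=> SP mE' fF'; rewrite !indicatorE; apply: (fiberwise_class SP); apply: nearW => g.
  have [mFE fFE] := finite_measure_setI fF' mE'; have [mF' fF''] := fF'.
  rewrite !indicL2E// scalerA !indicE in_setI; congr (_ *: _).
  by case: (g \in F'); case: (g \in E'); rewrite ?mulr1 ?mulr0.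
have cE u : D (SE u) = SE (D u) by have := congr1 (@^~ u) (D_commutes mE SEP).
have cF u : D (SF u) = SF (D u) by have := congr1 (@^~ u) (D_commutes mF SFP).
have fEF := finite_measure_setI fE mF.
transitivity (complex.Re (inner (D (SF (ind E x))) (ind F y))).
  by rewrite cF (aS _ _ SFP) (Sind _ _ _ _ SFP mF fF) setIid.
rewrite (Sind _ _ _ _ SFP mF fE).
have e1 : ind (E `&` F) x = SE (ind (E `&` F) x).
  by rewrite (Sind _ _ _ _ SEP mE fEF) setIAC setIid.
by rewrite [in LHS]e1 cE (aS _ _ SEP) (Sind _ _ _ _ SEP mE fF) (setIC F).
Qed.

(** Mixed terms reduce to diagonal ones by [diagonal_inner], so the diagonal pairing is finitely
    additive in [E]. *)
Lemma diagonal_additive E F x y : finite_measure_set mu E -> measurable F ->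
  complex.Re (inner (D (ind E x)) (ind E y)) =
  complex.Re (inner (D (ind (E `&` F) x)) (ind (E `&` F) y)) +
  complex.Re (inner (D (ind (E `\` F) x)) (ind (E `\` F) y)).
Proof.
move=> fE mF; have fEF := finite_measure_setI fE mF.
have fED := finite_measure_setI fE (measurableC mF).
have -> : ind E x = ind (E `&` F) x + ind (E `\` F) x.
  rewrite !indicatorE -L2classD; apply/L2class_eq; apply: nearW => g.
  have [mE E1] := fE; have [mEF EF1] := fEF; have [mED ED1] := fED.
  rewrite [RHS](_ : _ = indicL2 mu (E `&` F) x g + indicL2 mu (E `\` F) x g)//.
  rewrite setDE !indicL2E// -scalerDl !indicE !in_setI in_setC; congr (_ *: _).
  by case: (g \in E); case: (g \in F); rewrite ?addr0 ?add0r.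
rewrite (bounded_opD _ _ bD) innerDl ReD.
have e1 := diagonal_inner x y fEF fE; have e2 := diagonal_inner x y fED fE.
rewrite setIAC setIid in e1; rewrite setIAC setIid -setDE in e2.
by rewrite e1 e2.
Qed.

(** Both sides are additive in [E]: peel off the part inside the first set of the cover and recurse
    on the remainder. The cover may overlap. *)
Lemma diagonal_cover (V : seq (set (borel G))) x y (e : R) :
  (forall W, W \in V -> measurable W /\ forall E, finite_measure_set mu E -> E `<=` W ->
    `|complex.Re (inner (D (ind E x)) (ind E y))| <= e * fine (mu E)) ->
  forall E, finite_measure_set mu E ->
    (forall g, E g -> exists2 W, W \in V & W g) ->
    `|complex.Re (inner (D (ind E x)) (ind E y))| <= e * fine (mu E).
Proof.
elim: V => [_ E fE E0|W V IH VP E fE EV].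
  have -> : E = set0 by apply/seteqP; split => // g /E0[].
  have -> : ind set0 x = 0.
    rewrite indicatorE -L2class0; apply/L2class_eq; apply: nearW => g.
    by rewrite indicL2E ?measure0 ?ltry// indic0 scale0r.
  by rewrite (bounded_op0 bD) inner0l Re0 normr0 measure0 mulr0.
have [mW hW] := VP W (mem_head _ _).
have f1 := finite_measure_setI fE mW; have f2 := finite_measure_setI fE (measurableC mW).
have [mE E1] := fE; have [m1 E11] := f1; have [m2 E12] := f2.
rewrite (diagonal_additive _ _ fE mW).
have -> : fine (mu E) = fine (mu (E `&` W)) + fine (mu (E `\` W)).
  rewrite -fineD ?ge0_fin_numE// setDE; congr fine.
  by rewrite addeC -setDE; exact: measureDI.
rewrite mulrDr; apply: le_trans (ler_normD _ _) _; apply: lerD; first exact: hW.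
apply: IH => //.
  by move=> W' W'V; apply: VP; rewrite inE W'V orbT.
move=> g [Eg nW]; have [W' + W'g] := EV g Eg.
by rewrite inE => /orP[/eqP W'W|]; [case: nW; rewrite -W'W|exists W'].
Qed.

(** Split [E] along a compact [K] that nearly fills an open superset. On [E] within [K] the local
    estimates add up over a finite cover; off [K] the small measure is paired with boundedness of
    [D]. *)
Lemma diagonal_eq0 E x y : finite_measure_set mu E ->
  complex.Re (inner (D (ind E x)) (ind E y)) = 0.
Proof.
move=> fE; have [mE muE] := fE; have [M M0 DM] := bounded_op_le bD.
(* Chosen so that e/C times the two contributions, mu(E) and M |x| |y|, stays below e; the 1 makes
   it positive. *)
pose C := fine (mu E) + M * (hnorm x * hnorm y) + 1.
have C0 : 0 < C.
  have m0 : 0 <= fine (mu E) by exact: fine_ge0.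
  have := mulr_ge0 (ltW M0) (mulr_ge0 (hnorm_ge0 x) (hnorm_ge0 y)).
  by rewrite /C; lra.
apply/eqP; rewrite -normr_le0; apply/ler_addgt0Pr => e e0; rewrite add0r.
have d0 : 0 < e / C by rewrite divr_gt0.
have [U [oU EU fU]] := exists_open_finite mu_haar mE muE.
have [K [cK KU UK]] := exists_compact_approx G_hausdorff mu_haar oU fU d0.
have mK := borel_compact G_hausdorff cK.
have fEK := finite_measure_setI fE mK.
have fEK' : finite_measure_set mu (E `\` K).
  by rewrite setDE; apply: finite_measure_setI => //; exact: measurableC.
have /choice[V VP] (g0 : G) : exists V : set G, nbhs g0 V /\ forall E, finite_measure_set mu E ->
    E `<=` V -> `|complex.Re (inner (D (ind E x)) (ind E y))| <= e / C * fine (mu E).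
  by have [V] := D_local g0 x y d0; exists V.
have [|l lP] := compact_finite_cover (V := fun g => interior (V g)) cK.
  move=> g _; apply: open_nbhs_nbhs; split; first exact: open_interior.
  exact: (VP g).1.
have hK : `|complex.Re (inner (D (ind (E `&` K) x)) (ind (E `&` K) y))| <=
    e / C * fine (mu (E `&` K)).
  apply: (@diagonal_cover [seq (interior (V g) : set (borel G)) | g <- l]) => //.
    move=> _ /mapP[g _ ->]; split; first by apply: borel_open; exact: open_interior.
    by move=> E' fE' E'V; apply: (VP g).2 => // h /E'V; exact: interior_subset.
  move=> g [_ /lP[c cl Vc]]; exists (interior (V c)) => //.
  by apply/mapP; exists c.
have hK' : `|complex.Re (inner (D (ind (E `\` K) x)) (ind (E `\` K) y))| <=
    M * (e / C * (hnorm x * hnorm y)).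
  apply: le_trans (ler_norm_Re_inner _ _) _.
  apply: le_trans (ler_wpM2r (hnorm_ge0 _) (DM _)) _.
  rewrite -(mulrA M) (hnorm_ind_mul _ _ fEK') ler_wpM2l ?(ltW M0)//.
  rewrite ler_wpM2r ?mulr_ge0 ?hnorm_ge0//.
  have [mEK' EK'1] := fEK'.
  have : (mu (E `\` K) <= (e / C)%:E)%E.
    apply: le_trans UK; apply: le_measure; rewrite ?inE//.
      by apply: measurableD => //; exact: borel_open.
    by move=> g [Eg nK]; split => //; exact: EU.
  by rewrite -[X in (X <= _)%E](@fineK _ (mu (E `\` K))) ?ge0_fin_numE.
rewrite (diagonal_additive _ _ fE mK); apply: le_trans (ler_normD _ _) _.
apply: le_trans (lerD hK hK') _.
have le1 : fine (mu (E `&` K)) <= fine (mu E).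
  have [mEK EK1] := fEK.
  by apply: fine_le; rewrite ?ge0_fin_numE//; apply: le_measure; rewrite ?inE.
have le2 := ler_wpM2l (ltW d0) le1.
have eE : e = e / C * (fine (mu E) + M * (hnorm x * hnorm y) + 1).
  by rewrite -/C divfK// gt_eqF.
rewrite [leRHS]eE; move: le2 d0; move: (e / C) => t; lra.
Qed.

Lemma operator_eq0 u : D u = 0.
Proof.
apply: bounded_op_indic_eq0 u => // E F x y mE fE mF fF.
rewrite diagonal_inner//; apply: diagonal_eq0; exact: finite_measure_setI.
Qed.

End DiagonalOperators.

Theorem proposition4p2 (R : realType) (G : topologicalGroupType)
    (G_locally_compact : locally_compact [set: G])
    (G_hausdorff : hausdorff_space G)
    (mu : {measure set (borel G) -> \bar R})
    (mu_haar : left_haar_measure mu)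
    (B : cstarAlgType R) (alpha : G -> B -> B)
    (alpha_action : cstar_action alpha)
    (A : set B) (A_subalgebra : operator_subalgebra A)
    (A_invariant : forall (g : G) (a : B), A a -> A (alpha g a))
    (A_generates : cstar_generated A = [set: B])
    (H : hilbertType R) (pi : B -> H -> H)
    (pi_rep : star_representation pi)
    (pi_nondegenerate : nondegenerate_rep pi)
    (pi_uep : unique_extension_property A pi) :
  exists pi_alpha : B -> L2 mu H -> L2 mu H,
    is_pi_alpha alpha pi pi_alpha /\
    unique (fun psi : B -> L2 mu H -> L2 mu H =>
        [/\ ccp_map psi,
            forall a : B, A a -> psi a = pi_alpha a &
            forall b : B, tensor_Linfty mu H (psi b)])
      pi_alpha.
Proof.
(* [unique] includes membership, so the extension property itself provides complete contractivity of
   [pi]. *)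
have pi_ccp := pi_uep.1.1.
have [pa paP] := pi_alpha_exists G_hausdorff mu_haar alpha_action pi_rep pi_ccp.
have pa_ccp := pi_alpha_ccp alpha_action pi_rep pi_ccp paP.
have pa_tensor := pi_alpha_tensor G_hausdorff mu_haar alpha_action pi_rep pi_ccp paP.
exists pa; split=> //; split=> [|psi [psi_ccp psiA psi_tensor]]; first by split.
apply/funext => b; apply/funext => u; apply/eqP; rewrite eq_sym -subr_eq0; apply/eqP.
have bpsi := ccp_bounded psi_ccp b; have bpa := ccp_bounded pa_ccp b.
pose D v : L2 mu H := psi b v - pa b v.
have bD : bounded_op D.
  split=> [a v w|]; first by rewrite /D bpsi.1 bpa.1 scalerBr opprD addrACA.
  have [M M0 hM] := bounded_op_le bpsi; have [N N0 hN] := bounded_op_le bpa.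
  exists (M + N) => v; apply: le_trans (ler_hnormD _ _) _.
  by rewrite Defs.hnormN mulrDl lerD.
apply: (operator_eq0 G_hausdorff mu_haar bD) => [E S mE SP|g0 x y e e0].
  have h1 := tensor_commutes mE SP (psi_tensor b).
  have h2 := tensor_commutes mE SP (pa_tensor b).
  have [S_adds _] : bounded_op S.
    apply: (fiberwise_bounded ler01 SP).
      by move=> g a x y; rewrite scalerDr !scalerA mulrC.
    move=> g x; rewrite mul1r indicE; case: (g \in E); rewrite ?scale1r//.
    by rewrite scale0r hnorm0 hnorm_ge0.
  apply/funext => v; have /= k1 := congr1 (@^~ v) h1; have /= k2 := congr1 (@^~ v) h2.
  rewrite /D /= k1 k2 -scaleN1r addrC -S_adds; congr S.
  by rewrite scaleN1r addrC.
have e2 : 0 < e / 2 by rewrite divr_gt0.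
have [V1 V1g h1] := pi_alpha_local alpha_action pi_rep pi_ccp paP b g0 x y e2.
have [V2 V2g h2] := extension_local alpha_action pi_rep pi_ccp paP A_invariant pi_uep
  psi_ccp psiA b g0 x y e2.
exists (V1 `&` V2); first exact: filterI.
move=> E fE EV.
have k1 := h1 E fE (subset_trans EV (@subIsetl _ _ _)).
have k2 := h2 E fE (subset_trans EV (@subIsetr _ _ _)).
rewrite /D innerDl innerNl ReB.
(* Both pairings are within (e/2) mu(E) of the same value, given by the fibre at [g0]. *)
apply: le_trans (ler_distD
  (fine (mu E) * complex.Re (inner (pi (alpha (g0^-1)%g b) x) y)) _ _) _.
by rewrite [X in _ + X]distrC; apply: le_trans (lerD k2 k1) _; lra.
Qed.
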